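(* Let $p>1$, $s\ge r\ge2$ and $0<\varepsilon<1$. Let $Q$ be an $s$-vertex $r$-graph and let $\mathcal F$ be a family of $r$-graphs, none having isolated vertices, with $\pi:=\pi(Q,\overline{\mathcal F})>0$. Let $\mathcal G_n$ be the set of all $n$-vertex $\mathcal F$-free $r$-graphs $G$ with $\delta_Q(G)\ge(1-\varepsilon)\pi\binom{n}{s-1}$, and $\lambda^{(p)}(Q,\mathcal G_n)=\max\{\lambda^{(p)}(Q,G):G\in\mathcal G_n\}$. Put $\sigma=\varepsilon\pi/(5\,s!\,(s-1))$. Then there is $N$ (depending on $p,s,Q,\mathcal F,\varepsilon$) such that the following holds: if $n_0\ge N$ and for every $n\ge n_0$ $$\lambda^{(p)}(Q,\overline{\mathcal F}_n)\ge\lambda^{(p)}(Q,\overline{\mathcal F}_{n-1})+\pi\,(s-s/p)(1-\sigma)\,n^{s-s/p-1},$$ then for every $\mathcal F$-free $r$-graph $H$ on $n\ge n_0$ vertices, $\lambda^{(p)}(Q,H)\le\lambda^{(p)}(Q,\mathcal G_n)$; moreover, if equality holds, then $H\in\mathcal G_n$.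
   Context: An $r$-graph ($r\ge 2$) is a finite hypergraph all of whose edges have exactly $r$ vertices. For $I\subseteq V(H)$, $H[I]$ denotes the induced subhypergraph on $I$. For an $s$-vertex $r$-graph $Q$ and an $r$-graph $H$, $\mathcal N(Q,H)$ is the number of (not necessarily induced) subgraphs of $H$ isomorphic to $Q$. For an $n$-vertex $r$-graph $H$ with vertex set $[n]$ and $\mathbf x\in\mathbb R^n$, $P_{Q,H}(\mathbf x)=s!\sum_{\{i_1,\dots,i_s\}\in\binom{[n]}{s}}\mathcal N(Q,H[\{i_1,\dots,i_s\}])\,x_{i_1}\cdots x_{i_s}$, and for $p\ge1$, $\lambda^{(p)}(Q,H)=\max_{\|\mathbf x\|_p=1}P_{Q,H}(\mathbf x)$. The $Q$-degree of a vertex $v$ is $d_{Q,H}(v)=\sum\mathcal N(Q,H[I])$ over all $s$-subsets $I\subseteq V(H)$ containing $v$, and $\delta_Q(H)$ is the minimum $Q$-degree. An $r$-graph is $\mathcal F$-free if it contains no subgraph isomorphic to a member of $\mathcal F$; $\overline{\mathcal F}$ is the class of $\mathcal F$-free $r$-graphs and $\overline{\mathcal F}_n$ its members on $n$ vertices. $\lambda^{(p)}(Q,\overline{\mathcal F}_n)=\max\{\lambda^{(p)}(Q,H):H\in\overline{\mathcal F}_n\}$, $ex(Q,\overline{\mathcal F}_n)=\max\{\mathcal N(Q,H):H\in\overline{\mathcal F}_n\}$ and $\pi(Q,\overline{\mathcal F})=\lim_{n\to\infty}ex(Q,\overline{\mathcal F}_n)/\binom ns$ (this limit exists). *)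

(* Defs.v *)
From HB Require Import structures.
From mathcomp Require Import all_boot all_order all_algebra.
From mathcomp Require Import all_classical all_reals all_analysis.
Set Implicit Arguments. Unset Strict Implicit. Unset Printing Implicit Defensive.
Import Order.TTheory GRing.Theory Num.Theory.
Import numFieldNormedType.Exports.
Local Open Scope ring_scope.

Definition is_rgraph (r n : nat) (H : {set {set 'I_n}}) : Prop :=
  forall e, e \in H -> #|e| = r.

Definition no_isolated (m : nat) (E : {set {set 'I_m}}) : Prop :=
  forall v : 'I_m, exists2 e, e \in E & v \in e.

Definition contains (n m : nat) (H : {set {set 'I_n}}) (E : {set {set 'I_m}}) : Prop :=
  exists f : 'I_m -> 'I_n, injective f /\ forall e, e \in E -> f @: e \in H.

Definition Ffree (F : forall m : nat, {set {set 'I_m}} -> Prop)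
  (n : nat) (H : {set {set 'I_n}}) : Prop :=
  forall m (E : {set {set 'I_m}}), F m E -> ~ contains H E.

Definition is_copy (s n : nat) (Q : {set {set 'I_s}}) (I : {set 'I_n})
  (E' : {set {set 'I_n}}) : bool :=
  [exists f : {ffun 'I_s -> 'I_n},
     [&& injectiveb f, f @: setT == I & E' == (fun e : {set 'I_s} => f @: e) @: Q]].

(* N(Q, H[I]) : number of subgraphs of H[I] with vertex set I isomorphic to Q
   (for #|I| = s this is the number of subgraphs of H[I] isomorphic to Q). *)
Definition NQI (s n : nat) (Q : {set {set 'I_s}}) (H : {set {set 'I_n}})
  (I : {set 'I_n}) : nat :=
  #|[set E' : {set {set 'I_n}} | (E' \subset H) && is_copy Q I E']|.

Definition NQ (s n : nat) (Q : {set {set 'I_s}}) (H : {set {set 'I_n}}) : nat :=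
  (\sum_(I : {set 'I_n} | #|I| == s) NQI Q H I)%N.

Definition degQ (s n : nat) (Q : {set {set 'I_s}}) (H : {set {set 'I_n}}) (v : 'I_n) : nat :=
  (\sum_(I : {set 'I_n} | (#|I| == s) && (v \in I)) NQI Q H I)%N.

Definition PQ (R : realType) (s n : nat) (Q : {set {set 'I_s}}) (H : {set {set 'I_n}})
  (x : 'I_n -> R) : R :=
  (s`!)%:R * \sum_(I : {set 'I_n} | #|I| == s) (NQI Q H I)%:R * \prod_(i in I) x i.

Definition pnorm (R : realType) (p : R) (n : nat) (x : 'I_n -> R) : R :=
  (\sum_(i < n) `|x i| `^ p) `^ (1 / p).

Definition lambdaQ (R : realType) (p : R) (s n : nat) (Q : {set {set 'I_s}})
  (H : {set {set 'I_n}}) : R :=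
  sup [set PQ Q H x | x in [set x : 'I_n -> R | pnorm p x = 1]]%classic.

Definition Ffree_class (r : nat) (F : forall m : nat, {set {set 'I_m}} -> Prop) (n : nat)
  : set {set {set 'I_n}} :=
  [set H | is_rgraph r H /\ Ffree F H]%classic.
Arguments Ffree_class r F n _ : clear implicits.

Definition lambda_class (R : realType) (p : R) (s n : nat) (Q : {set {set 'I_s}})
  (C : set {set {set 'I_n}}) : R :=
  sup [set lambdaQ p Q H | H in C]%classic.

Definition exQ (R : realType) (r s : nat) (Q : {set {set 'I_s}})
  (F : forall m : nat, {set {set 'I_m}} -> Prop) (n : nat) : R :=
  sup [set ((NQ Q H)%:R : R) | H in Ffree_class r F n]%classic.

Definition Gclass (R : realType) (r s : nat) (Q : {set {set 'I_s}})
  (F : forall m : nat, {set {set 'I_m}} -> Prop) (eps pi : R) (n : nat)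
  : set {set {set 'I_n}} :=
  [set G | is_rgraph r G /\ Ffree F G /\
           forall v : 'I_n, (degQ Q G v)%:R >= (1 - eps) * pi * ('C(n, s.-1))%:R]%classic.
Arguments Gclass {R} r {s} Q F eps pi n _.

(* Main.v *)
Require Import Defs.
From HB Require Import structures.
From mathcomp Require Import all_boot all_order all_algebra.
From mathcomp Require Import all_classical all_reals all_analysis.
From mathcomp Require Import ring lra.
Import Order.TTheory GRing.Theory Num.Theory.
Import numFieldNormedType.Exports.
Local Open Scope ring_scope.

Set Implicit Arguments.
Unset Strict Implicit.
Unset Printing Implicit Defensive.

(** Write [rho = s - s/p] and let [L_n] be the largest spectral value over the
    F-free r-graphs on [n] vertices. If [x] is a nonnegative unit maximizer for
    an extremal [H] and [t = x_v ^ p], Lagrange's condition shows that deleting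
    [v] costs a factor [(1 - s t) / (1 - t)^(s/p)], so
    [L_(n-1) >= L_n (1 - rho t - O(t^2))]; taking the least coordinate,
    [t <= 1/n], so [L_n / n^rho] is nonincreasing up to a summable error.
    Its decrease cannot be of order [1/n] for all large [n], hence infinitely
    often every coordinate has [x_i ^ p >= (1 - delta) / n]; such an almost
    uniform [x] gives [L_n] at most about [pi n^rho], and by monotonicity
    [L_n ~ pi n^rho].
    Now the growth hypothesis and the deletion inequality force
    [x_i ^ p >= (1 - sigma - o(1)) / n] for every extremal [H] on [n] vertices,
    and Lagrange's condition at any vertex [v], compared with the uniform
    vector, bounds its Q-degree below by [(1 - eps) pi 'C(n, s-1)]. So all
    extremal graphs lie in the class of large minimum Q-degree. *)

(** * Copies of [Q] and deletion of a vertex *)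

(* In [Defs], [setT] is the full classical set, coerced to a predicate. *)
Lemma is_copyP (s n : nat) (Q : {set {set 'I_s}}) (I : {set 'I_n})
  (E' : {set {set 'I_n}}) :
  reflect (exists f : {ffun 'I_s -> 'I_n},
     [/\ injective f, f @: finset.setT = I &
         E' = (fun e : {set 'I_s} => f @: e) @: Q])
    (is_copy Q I E').
Proof.
have TE (f : {ffun 'I_s -> 'I_n}) : f @: [set: 'I_s]%classic = f @: finset.setT.
  by apply/setP => j; apply/imsetP/imsetP => -[i _ ->]; exists i => //; exact/mem_set.
apply: (iffP existsP) => -[f].
  by rewrite TE => /and3P[/injectiveP fi /eqP fI /eqP fE]; exists f.
by move=> [fi fI fE]; exists f; rewrite TE; apply/and3P; split;
  [exact/injectiveP|exact/eqP|exact/eqP].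
Qed.

(** An injection from ['I_s] into a set of size [s] is onto it, so the maps counted are the
    injections into [I], of which there are [s ^_ s]. *)
Lemma card_ffun_onto (s n : nat) (I : {set 'I_n}) : #|I| = s ->
  #|[set f : {ffun 'I_s -> 'I_n} | injectiveb f & f @: finset.setT == I]| = s`!.
Proof.
move=> cI; have -> : s`! = #|I| ^_ #|'I_s| by rewrite cI card_ord ffactnn.
rewrite -card_inj_ffuns_on.
apply: eq_card => f; rewrite !inE; case: (boolP (injectiveb f)) => finj; rewrite ?andbF// !andbT.
have cf : #|f @: finset.setT| = s by rewrite card_imset ?cardsT ?card_ord//; apply/injectiveP.
apply/eqP/ffun_onP => [<- x|fI]; first exact: imset_f.
apply/eqP; rewrite eqEcard cf cI leqnn andbT.
by apply/fintype.subsetP => _ /imsetP[x _ ->].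
Qed.

(** Each copy with vertex set [I] is the image of [Q] under one of the s! bijections onto [I]. *)
Lemma NQI_le_fact (s n : nat) (Q : {set {set 'I_s}}) (H : {set {set 'I_n}})
  (I : {set 'I_n}) : #|I| = s -> (NQI Q H I <= s`!)%N.
Proof.
move=> cI; rewrite -(card_ffun_onto cI).
set A := [set f : {ffun _} | _ & _].
apply: leq_trans (leq_imset_card
  (fun f : {ffun 'I_s -> 'I_n} => (fun e : {set 'I_s} => f @: e) @: Q) A).
apply: subset_leq_card; apply/fintype.subsetP => E'.
rewrite inE => /andP[_ /is_copyP[f [fi fI ->]]].
by apply: imset_f; rewrite inE fI eqxx andbT; apply/injectiveP.
Qed.

(** A copy of [Q] spanning [lift v @: I] pulls back along [lift v]. One inequality suffices, since
    deletion only serves to bound the smaller graph from below. *)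
Lemma NQI_lift_le (s m : nat) (Q : {set {set 'I_s}}) (v : 'I_m.+1)
  (H : {set {set 'I_m.+1}}) (I : {set 'I_m}) :
  (NQI Q H (lift v @: I) <= NQI Q [set e : {set 'I_m} | lift v @: e \in H] I)%N.
Proof.
rewrite /NQI.
set A := [set E' : {set {set 'I_m}} | _ & _].
apply: leq_trans (leq_imset_card
  (fun E : {set {set 'I_m}} => (fun e : {set 'I_m} => lift v @: e) @: E) A).
apply: subset_leq_card; apply/fintype.subsetP => E'.
rewrite inE => /andP[E'H /is_copyP[f [fi fI E'E]]].
have fv i : {j | lift v j = f i}.
  have : f i \in lift v @: I by rewrite -fI imset_f.
  by by move=> /imsetP/cid2[j _ ->]; exists j.
pose g := [ffun i => sval (fv i)].
have gE i : lift v (g i) = f i by rewrite ffunE; case: (fv i).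
have gfE (e : {set 'I_s}) : lift v @: (g @: e) = f @: e.
  by rewrite -imset_comp; apply: eq_imset => i /=; rewrite gE.
apply/imsetP; exists ((fun e : {set 'I_s} => g @: e) @: Q); last first.
  by rewrite E'E -imset_comp; apply: eq_imset => e /=; rewrite gfE.
rewrite inE; apply/andP; split.
  apply/fintype.subsetP => _ /imsetP[e eQ ->]; rewrite inE gfE.
  by apply: (fintype.subsetP E'H); rewrite E'E imset_f.
apply/is_copyP; exists g; split=> //.
  by move=> i j /(congr1 (lift v)); rewrite !gE => /fi.
by apply: (imset_inj (@lift_inj _ v)); rewrite gfE.
Qed.

Lemma Ffree_class_delete (r m : nat) (F : forall m : nat, {set {set 'I_m}} -> Prop)
  (H : {set {set 'I_m.+1}}) (v : 'I_m.+1) :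
  Ffree_class r F m.+1 H ->
  Ffree_class r F m [set e : {set 'I_m} | lift v @: e \in H].
Proof.
move=> [Hr HF]; split=> [e|k E FE [f [fi fE]]].
  by rewrite inE => /Hr <-; rewrite card_imset//; exact: lift_inj.
apply: (HF k E FE); exists (lift v \o f); split.
  by move=> i j /= /lift_inj /fi.
by move=> e /fE; rewrite inE -imset_comp.
Qed.

(** * Elementary inequalities for sums, products and powers *)

(** Expand the power over all maps from ['I_k] to ['I_n]: each [k]-set is the image of k! injective
    maps, and the remaining terms are nonnegative. *)
Lemma sum_prod_subsets_le (R : realDomainType) (n k : nat) (y : 'I_n -> R) :
  (forall i, 0 <= y i) ->
  k`!%:R * (\sum_(J : {set 'I_n} | #|J| == k) \prod_(i in J) y i)
    <= (\sum_i y i) ^+ k.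
Proof.
move=> y0.
have -> : (\sum_i y i) ^+ k = \prod_(j : 'I_k) \sum_i y i.
  by rewrite prodr_const card_ord.
rewrite bigA_distr_bigA/=.
rewrite (bigID (fun f : {ffun 'I_k -> 'I_n} => injectiveb f))/=.
apply: ler_wpDr; first by apply: sumr_ge0 => f _; apply: prodr_ge0.
rewrite (partition_big (fun f : {ffun 'I_k -> 'I_n} => f @: finset.setT)
  (fun J : {set 'I_n} => #|J| == k))/=; last first.
  by move=> f /injectiveP fi; rewrite card_imset// cardsT card_ord.
rewrite mulr_sumr; apply: ler_sum => J /eqP cJ.
rewrite [leRHS](eq_bigr (fun=> \prod_(i in J) y i)).
  rewrite (eq_bigl (fun f => f \in [set f : {ffun 'I_k -> 'I_n} |
    injectiveb f & f @: finset.setT == J])); last by move=> f; rewrite [RHS]inE.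
  rewrite -(card_ffun_onto cJ) mulr_natl; set A := [set f : {ffun _} | _ & _].
  by rewrite sumr_const.
move=> f /andP[/injectiveP fi /eqP <-].
rewrite big_imset/=; last by move=> i j _ _ /fi.
by apply: eq_bigl => i; rewrite !inE.
Qed.

Lemma powR_gt1 (R : realType) (p y : R) : 0 < p -> 1 < y -> 1 < y `^ p.
Proof.
move=> p0 y1; have : 1 `^ p < y `^ p.
  by apply: gt0_ltr_powR => //; rewrite nnegrE; lra.
by rewrite powR1.
Qed.

(** Both factors are compared with exponentials, through [1 - t <= expR (- t)] and
    [1 + a t <= expR (a t)]. This trades a real power for a linear factor. *)
Lemma powR_onem_Bernoulli (R : realType) (a t : R) : 0 <= a -> t < 1 ->
  (1 - t) `^ a * (1 + a * t) <= 1.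
Proof.
move=> a0 t1; have t1' : 0 < 1 - t by lra.
apply: (@le_trans _ _ (expR (- (a * t)) * expR (a * t))); last first.
  by rewrite -expRD addNr expR0.
apply: (@le_trans _ _ ((1 - t) `^ a * expR (a * t))).
  by rewrite ler_wpM2l ?powR_ge0 ?expR_ge1Dx.
rewrite ler_wpM2r ?expR_ge0// /powR gt_eqF// ler_expR -mulrN ler_wpM2l//.
by apply: le_ln1Dx; lra.
Qed.

(** Young's inequality for the product [y * 1], with [p] and its conjugate exponent. *)
Lemma le_powR_tangent (R : realType) (p y : R) : 1 < p -> 0 <= y ->
  y <= 1 + (y `^ p - 1) / p.
Proof.
move=> p1 y0; have p0 : 0 < p by lra.
have pi0 : 0 < p^-1 by rewrite invr_gt0.
have pi1 : p^-1 < 1 by rewrite invf_lt1.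
have q0 : 0 < (1 - p^-1)^-1 by rewrite invr_gt0; lra.
have := @conjugate_powR _ y 1 p (1 - p^-1)^-1 y0 ler01 p0 q0.
rewrite invrK powR1 mulr1 => /(_ _)/le_trans; apply; first by lra.
by rewrite mul1r mulrBl mul1r; lra.
Qed.

Lemma expr_onem_Bernoulli (R : realDomainType) (d : R) (k : nat) :
  0 <= d -> d <= 1 -> 1 - k%:R * d <= (1 - d) ^+ k.
Proof.
move=> d0 d1; elim: k => [|k IH]; first by rewrite expr0; lra.
have : (1 - d) * (1 - k%:R * d) <= (1 - d) ^+ k.+1.
  by rewrite exprS ler_wpM2l//; lra.
apply: le_trans; rewrite -natr1.
have : 0 <= k%:R * d * d by rewrite !mulr_ge0.
by lra.
Qed.

Lemma ge_onem_powR (R : realType) (p d y : R) : 1 < p -> 0 <= y -> 0 <= d ->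
  1 - d <= y `^ p -> 1 - d <= y.
Proof.
move=> p1 y0 d0 dy; have [y1|y1] := leP 1 y; first by lra.
have [yE|yN0] := eqVneq y 0.
  by move: dy; rewrite yE powR0//; lra.
apply: le_trans dy _; apply: ge1r_powR; last exact: ltW.
by rewrite lt_def yN0 y0 ltW.
Qed.

(** Sum the tangent bound over the coordinates; the correction terms have a nonpositive total. *)
Lemma sum_le_of_sum_powR_le (R : realType) (p : R) (n : nat) (y : 'I_n -> R) :
  1 < p -> (forall i, 0 <= y i) -> \sum_i y i `^ p <= n%:R ->
  \sum_i y i <= n%:R.
Proof.
move=> p1 y0 yn; have p0 : 0 < p by lra.
apply: (@le_trans _ _ (\sum_i (1 + (y i `^ p - 1) / p))).
  by apply: ler_sum => i _; exact: le_powR_tangent.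
have s1 : \sum_(i < n) (1 : R) = n%:R by rewrite sumr_const card_ord.
by rewrite big_split/= -mulr_suml sumrB s1 gerDl pmulr_lle0 ?invr_gt0// subr_le0.
Qed.

(* The factor [W - w J] is nonnegative and [\prod_(i in J) y i] is at least
   [c := 1 - k d], so replacing [w J] by [W] in [w J * (\prod y - c)] only
   increases the sum, which Maclaurin's inequality then bounds. *)
Lemma near_uniform_sum_le (R : realType) (p d W : R) (n k : nat)
  (y : 'I_n -> R) (w : {set 'I_n} -> R) :
  1 < p -> 0 <= d -> d <= 1 -> 0 <= W ->
  (forall i, 0 <= y i) -> \sum_i y i `^ p <= n%:R ->
  (forall i, 1 - d <= y i `^ p) ->
  (forall J : {set 'I_n}, #|J| = k -> 0 <= w J <= W) ->
  \sum_(J : {set 'I_n} | #|J| == k) w J * \prod_(i in J) y i <=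
  \sum_(J : {set 'I_n} | #|J| == k) w J
  + W * (n%:R ^+ k / k`!%:R - (1 - k%:R * d) * 'C(n, k)%:R).
Proof.
move=> p1 d0 d1 W0 y0 yn yd ww; pose c := 1 - k%:R * d.
have p0 : 0 < p by lra.
have cle (J : {set 'I_n}) : #|J| = k -> c <= \prod_(i in J) y i.
  move=> cJ; apply: le_trans (expr_onem_Bernoulli k d0 d1) _.
  rewrite -cJ -prodr_const; apply: ler_prod => i _.
  by rewrite (ge_onem_powR p1)// andbT; lra.
have sumy := sum_le_of_sum_powR_le p1 y0 yn.
have ey : \sum_(J : {set 'I_n} | #|J| == k) \prod_(i in J) y i
    <= n%:R ^+ k / k`!%:R.
  rewrite ler_pdivlMr ?ltr0n ?fact_gt0// mulrC.
  apply: le_trans (sum_prod_subsets_le k y0) _.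
  by rewrite lerXn2r ?sumy ?nnegrE ?sumr_ge0 ?ler0n.
have card_k : \sum_(J : {set 'I_n} | #|J| == k) (1 : R) = 'C(n, k)%:R.
  rewrite sumr_const; congr (_%:R).
  rewrite -[n in RHS]card_ord -card_draws.
  by apply: eq_card => J; rewrite !inE.
apply: (@le_trans _ _ (\sum_(J : {set 'I_n} | #|J| == k)
   (w J + W * (\prod_(i in J) y i - c * 1)))).
  apply: ler_sum => J /eqP cJ; have /andP[w0 wW] := ww J cJ.
  have : 0 <= (W - w J) * (\prod_(i in J) y i - c).
    by rewrite mulr_ge0// subr_ge0// cle.
  have : 0 <= w J * (1 - c).
    have kd : 0 <= k%:R * d by rewrite mulr_ge0.
    by rewrite mulr_ge0// /c; lra.
  by lra.
rewrite big_split/= lerD2l -mulr_sumr ler_wpM2l//.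
by rewrite sumrB -mulr_sumr card_k -/c; lra.
Qed.

(** * Continuity of [PQ] and compactness of the unit sphere *)

Lemma continuous_norm_powR (R : realType) (p : R) : 0 < p ->
  continuous (fun a : R => `|a| `^ p).
Proof.
move=> p0 a; have [->|a0] := eqVneq a 0; last first.
  apply: (@continuous_comp _ _ _ (fun b : R => `|b|) (fun b => b `^ p)).
    exact: norm_continuous.
  apply: differentiable_continuous; apply/derivable1_diffP.
  by apply: derivable_powR; rewrite in_itv/= normr_gt0 a0.
(* At the origin, where the power need not be differentiable, the radius e^(1/p) works directly. *)
rewrite /continuous_at normr0 powR0 ?gt_eqF//.
apply/cvgr0Pnorm_lt => e e0; near=> b.
rewrite ger0_norm ?powR_ge0// -[ltRHS](powRr1 (ltW e0)) -(mulVf (lt0r_neq0 p0)) powRrM.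
rewrite gt0_ltr_powR ?nnegrE ?powR_ge0//.
near: b; exists (e `^ p^-1); first by rewrite /= powR_gt0.
by move=> b /=; rewrite sub0r normrN.
Unshelve. all: by end_near. Qed.

Lemma continuous_bigsum (R : numFieldType) (T : topologicalType) (I : Type)
  (r : seq I) (P : pred I) (f : I -> T -> R) :
  (forall i, continuous (f i)) -> continuous (fun x => \sum_(i <- r | P i) f i x).
Proof.
move=> cf x; elim: r => [|i r IH].
  rewrite (_ : (fun _ => _) = cst 0); first exact: cst_continuous.
  by apply/funext => z; rewrite big_nil.
rewrite (_ : (fun _ => _) =
  if P i then f i \+ (fun x => \sum_(i <- r | P i) f i x)
  else fun x => \sum_(i <- r | P i) f i x); last first.
  by apply/funext => z; rewrite big_cons; case: (P i).
by case: (P i) => //; apply: continuousD => //; exact: cf.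
Qed.

Lemma continuous_bigprod (R : numFieldType) (T : topologicalType) (I : Type)
  (r : seq I) (P : pred I) (f : I -> T -> R) :
  (forall i, continuous (f i)) -> continuous (fun x => \prod_(i <- r | P i) f i x).
Proof.
move=> cf x; elim: r => [|i r IH].
  rewrite (_ : (fun _ => _) = cst 1); first exact: cst_continuous.
  by apply/funext => z; rewrite big_nil.
rewrite (_ : (fun _ => _) =
  if P i then f i \* (fun x => \prod_(i <- r | P i) f i x)
  else fun x => \prod_(i <- r | P i) f i x); last first.
  by apply/funext => z; rewrite big_cons; case: (P i).
by case: (P i) => //; apply: continuousM => //; exact: cf.
Qed.

Lemma pnorm_eq1 (R : realType) (p : R) (n : nat) (x : 'I_n -> R) : 0 < p ->
  (pnorm p x = 1) <-> (\sum_i `|x i| `^ p = 1).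
Proof.
move=> p0; rewrite /pnorm; set S := \sum_i _; split=> [S1|->]; last by rewrite powR1.
have S0 : 0 <= S by apply: sumr_ge0 => i _; exact: powR_ge0.
have -> : S = (S `^ (1 / p)) `^ p.
  by rewrite -powRrM div1r mulVf ?lt0r_neq0// powRr1.
by rewrite S1 powR1.
Qed.

Section PQ_theory.
Context (R : realType) (s n : nat) (Q : {set {set 'I_s}}) (H : {set {set 'I_n}}).
Implicit Types x : 'I_n -> R.

Lemma PQ_homogeneous (c : R) x : PQ Q H (fun i => c * x i) = c ^+ s * PQ Q H x.
Proof.
rewrite /PQ mulrCA; congr (_ * _); rewrite mulr_sumr; apply: eq_bigr => I /eqP cI.
by rewrite big_split/= prodr_const cI mulrCA.
Qed.

Lemma PQ_ge0 x : (forall i, 0 <= x i) -> 0 <= PQ Q H x.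
Proof.
move=> x0; rewrite mulr_ge0//; apply: sumr_ge0 => I _.
by rewrite mulr_ge0//; exact: prodr_ge0.
Qed.

Lemma PQ_le_norm x : PQ Q H x <= PQ Q H (fun i => `|x i|).
Proof.
rewrite ler_wpM2l//; apply: ler_sum => I _; rewrite ler_wpM2l//.
by rewrite -normr_prod ler_norm.
Qed.

Lemma PQ_le_sum_expr x : (forall i, 0 <= x i) ->
  PQ Q H x <= s`!%:R * (\sum_i x i) ^+ s.
Proof.
move=> x0; rewrite /PQ ler_wpM2l//.
apply: le_trans (sum_prod_subsets_le s x0).
rewrite mulr_sumr; apply: ler_sum => I /eqP cI.
by rewrite ler_wpM2r ?prodr_ge0// ler_nat NQI_le_fact.
Qed.

Lemma continuous_PQ : continuous (fun v : 'rV[R]_n => PQ Q H (v ord0)).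
Proof.
move=> v; apply: (@continuousM _ _ (cst _) (fun v : 'rV[R]_n =>
  \sum_(I : {set 'I_n} | #|I| == s) (NQI Q H I)%:R * \prod_(i in I) v ord0 i)).
  exact: cst_continuous.
apply: continuous_bigsum => I u; apply: (@continuousM _ _ (cst _)
  (fun v : 'rV[R]_n => \prod_(i in I) v ord0 i)); first exact: cst_continuous.
by apply: continuous_bigprod => i w; exact: coord_continuous.
Qed.

End PQ_theory.

(** The sphere is the preimage of 1 under a continuous map and lies in the cube with sides
    [[-1, 1]]. *)
Lemma compact_lp_sphere (R : realType) (p : R) (n : nat) : 0 < p ->
  compact [set v : 'rV[R]_n | \sum_i `|v ord0 i| `^ p = 1].
Proof.
move=> p0.
have cf : continuous (fun v : 'rV[R]_n => \sum_i `|v ord0 i| `^ p).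
  apply: continuous_bigsum => i v.
  apply: (@continuous_comp _ _ _ (fun v : 'rV[R]_n => v ord0 i)
            (fun a => `|a| `^ p)).
    exact: coord_continuous.
  exact: continuous_norm_powR.
have cA := @rV_compact R n (fun=> `[(- 1), 1]%classic)
  (fun=> @segment_compact R (-1) 1).
apply: subclosed_compact cA _.
  exact: (continuous_closedP _).1 cf _ (@closed_eq _ 1).
move=> v /= v1 i; rewrite in_itv/= -ler_norml.
rewrite leNgt; apply/negP => vi.
have := powR_gt1 p0 vi.
rewrite ltNge -[leRHS]v1 (bigD1 i)//= lerDl sumr_ge0// => j _; exact: powR_ge0.
Qed.

(** * Nonnegative maximizers and Lagrange's condition *)

Section maximizer.
Context (R : realType) (p : R) (s n : nat).
Context (Q : {set {set 'I_s}}) (H : {set {set 'I_n}}).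
Hypothesis p1 : 1 < p.
Hypothesis s0 : (0 < s)%N.
Let p0 : 0 < p. Proof. exact: lt_trans ltr01 p1. Qed.

Definition maximizer (x : 'I_n -> R) : Prop :=
  [/\ forall i, 0 <= x i, \sum_i x i `^ p = 1 & PQ Q H x = lambdaQ p Q H].

(** A maximum over the compact sphere is attained; taking absolute values of the coordinates keeps
    the norm and does not decrease [PQ]. For [n = 0] the sphere is empty. *)
Lemma maximizer_exists : (0 < n)%N -> exists x, maximizer x.
Proof.
move=> n0.
pose A := [set v : 'rV[R]_n | \sum_i `|v ord0 i| `^ p = 1]%classic.
have A0 : (A !=set0)%classic.
  exists (\row_j (j == Ordinal n0)%:R); rewrite /A /=.
  rewrite (bigD1 (Ordinal n0))//= mxE eqxx normr1 powR1 big1 ?addr0// => i iN0.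
  by rewrite mxE (negbTE iN0) normr0 powR0 ?lt0r_neq0.
have [c cA cmax] := EVT_max_rV A0 (@compact_lp_sphere _ p n p0)
  (continuous_subspaceT (@continuous_PQ R s n Q H)).
have cA' : \sum_i `|c ord0 i| `^ p = 1 by move/set_mem : cA.
exists (fun i => `|c ord0 i|); split=> //.
pose S := [set PQ Q H x | x in [set x : 'I_n -> R | pnorm p x = 1]]%classic.
have ubS : ubound S (PQ Q H (c ord0)).
  move=> _ [z /= /(pnorm_eq1 _ p0) z1 <-].
  have -> : z = (\row_i z i) ord0 by apply/funext => i; rewrite mxE.
  apply: cmax; apply/mem_set => /=.
  by rewrite /A/= -[RHS]z1; apply: eq_bigr => i _; rewrite mxE.
have Sc : S (PQ Q H (fun i => `|c ord0 i|)).
  exists (fun i => `|c ord0 i|) => //=; apply/(pnorm_eq1 _ p0).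
  by rewrite -[RHS]cA'; apply: eq_bigr => i _; rewrite normr_id.
apply/eqP; rewrite eq_le; apply/andP; split.
  by apply: ub_le_sup => //; exists (PQ Q H (c ord0)).
apply: le_trans (PQ_le_norm _ _ _); apply: ge_sup => //.
by exists (PQ Q H (fun i => `|c ord0 i|)).
Qed.

Lemma lambdaQ_ge0 : 0 <= lambdaQ p Q H.
Proof.
have [n0|n0] := posnP n; last first.
  by have [x [x0 _ <-]] := maximizer_exists n0; exact: PQ_ge0.
have -> : lambdaQ p Q H = sup classical_sets.set0; last by rewrite sup0.
congr sup; rewrite -subset0 => _ [z /= /(pnorm_eq1 _ p0) + _].
rewrite big1; first by move/eqP; rewrite eq_sym oner_eq0.
by case=> i Hi; exfalso; move: Hi; rewrite n0.
Qed.

(** Homogeneity extends the bound from the unit sphere to all vectors. The zero vector is treated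
    apart; there [PQ] vanishes because [s > 0]. *)
Lemma PQ_le_lambdaQ (z : 'I_n -> R) :
  PQ Q H z <= lambdaQ p Q H * (\sum_i `|z i| `^ p) `^ (s%:R / p).
Proof.
set T := \sum_i _.
have T0 : 0 <= T by apply: sumr_ge0 => i _; exact: powR_ge0.
have [TE|TN0] := eqVneq T 0.
  have z0 i : z i = 0.
    have : \sum_i `|z i| `^ p = 0 := TE.
    move=> /psumr_eq0P => /(_ (fun i _ => powR_ge0 _ _) i isT) /powR_eq0_eq0.
    by move/eqP; rewrite normr_eq0 => /eqP.
  rewrite /PQ big1 ?mulr0 ?mulr_ge0 ?lambdaQ_ge0 ?powR_ge0// => I /eqP cI.
  have /card_gt0P[i iI] : (0 < #|I|)%N by rewrite cI.
  by rewrite (bigD1 i)//= z0 mul0r mulr0.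
have Tp : 0 < T by rewrite lt_def TN0.
have n0 : (0 < n)%N.
  by rewrite lt0n; apply: contra_neq TN0 => n0; rewrite /T big1// => -[i Hi];
     exfalso; move: Hi; rewrite n0.
pose c := T `^ (- p^-1).
have cp : c `^ p = T^-1.
  by rewrite -powRrM mulNr mulVf ?lt0r_neq0// powR_inv1.
have cs : c ^+ s * T `^ (s%:R / p) = 1.
  rewrite -powR_mulrn ?powR_ge0// -powRrM mulNr [_^-1 * _]mulrC -powRD.
    by rewrite addNr powRr0.
  by rewrite TN0 implybT.
have c0 : 0 < c by rewrite powR_gt0.
have Hz : c ^+ s * PQ Q H z <= lambdaQ p Q H.
  have cz1 : \sum_i `|c * z i| `^ p = 1.
    under eq_bigr do rewrite normrM powRM// ger0_norm ?(ltW c0)// cp.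
    by rewrite -mulr_sumr mulVf.
  rewrite -PQ_homogeneous; apply: ub_le_sup; last first.
    by exists (fun i => c * z i) => //=; apply/(pnorm_eq1 _ p0).
  (* The supremum needs some upper bound: a unit vector has coordinates of modulus at most 1, so the
     moduli sum to at most [n]. *)
  exists (s`!%:R * n%:R ^+ s) => _ [y /= /(pnorm_eq1 _ p0) y1 <-].
  apply: le_trans (PQ_le_norm _ _ _) _.
  apply: le_trans (PQ_le_sum_expr _ _ _) _ => //.
  rewrite ler_wpM2l// lerXn2r ?nnegrE ?sumr_ge0//.
  have -> : (n%:R : R) = \sum_(i < n) 1 by rewrite sumr_const card_ord.
  apply: ler_sum => i _; rewrite leNgt; apply/negP => yi.
  have := powR_gt1 p0 yi.
  rewrite ltNge -[leRHS]y1 (bigD1 i)//= lerDl sumr_ge0// => j _; exact: powR_ge0.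
have -> : PQ Q H z = (c ^+ s * PQ Q H z) * T `^ (s%:R / p).
  by rewrite mulrAC cs mul1r.
by rewrite ler_wpM2r// powR_ge0.
Qed.

(** Variation of one coordinate; [h = 0] amounts to deleting [v]. *)
Definition scale_at (v : 'I_n) (h : R) (x : 'I_n -> R) :=
  fun i => if i == v then h * x i else x i.

(** This is [x v] times the partial derivative of [PQ] in that coordinate; keeping the factor avoids
    dividing by a coordinate that may be zero. *)
Definition linkQ (v : 'I_n) (x : 'I_n -> R) : R := s`!%:R *
  \sum_(I : {set 'I_n} | (#|I| == s) && (v \in I)) (NQI Q H I)%:R * \prod_(i in I) x i.

(** [PQ] is multilinear, hence affine in [h]. *)
Lemma PQ_scale_at v h x : PQ Q H (scale_at v h x) = PQ Q H x + (h - 1) * linkQ v x.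
Proof.
rewrite /PQ /linkQ [(h - 1) * _]mulrCA -mulrDr; congr (_ * _).
rewrite !(bigID (fun I : {set 'I_n} => v \in I) (fun I => #|I| == s))/=.
rewrite addrAC; congr (_ + _); last first.
  apply: eq_bigr => I /andP[_ vI]; congr (_ * _); apply: eq_bigr => i iI.
  by rewrite /scale_at; case: eqP => // iv; move: vI; rewrite -iv iI.
rewrite mulrBl mul1r addrC subrK mulr_sumr; apply: eq_bigr => I /andP[_ vI].
rewrite mulrCA; congr (_ * _); rewrite (bigD1 v)//= [in RHS](bigD1 v)//= mulrA.
congr (_ * _); first by rewrite /scale_at eqxx.
by apply: eq_bigr => i /andP[_ iv]; rewrite /scale_at (negbTE iv).
Qed.

Lemma sum_scale_at v h x : 0 <= h -> (forall i, 0 <= x i) ->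
  \sum_i `|scale_at v h x i| `^ p = \sum_i x i `^ p + (h `^ p - 1) * x v `^ p.
Proof.
move=> h0 x0; rewrite (bigD1 v)//= [in RHS](bigD1 v)//= {1}/scale_at eqxx.
rewrite ger0_norm ?mulr_ge0// powRM// mulrBl mul1r.
rewrite (eq_bigr (fun i => x i `^ p)); first by rewrite addrACA addrC; ring.
by move=> i iv; rewrite /scale_at (negbTE iv) ger0_norm.
Qed.

Lemma maximizer_le1 x v : maximizer x -> x v `^ p <= 1.
Proof.
move=> [_ <- _]; rewrite (bigD1 v)//= lerDl sumr_ge0// => i _; exact: powR_ge0.
Qed.

(* Lagrange's condition in the direction of [x v], stated without dividing by
   [x v]: stretching the coordinate [v] by a factor [h] keeps
   [PQ <= lambda * norm ^ s], with equality at [h = 1]. *)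
Lemma maximizer_linkQ x v : maximizer x ->
  linkQ v x = s%:R * lambdaQ p Q H * x v `^ p.
Proof.
move=> xmax; have [x0 x1 xl] := xmax; set L := lambdaQ p Q H in xl *; set t := x v `^ p.
have t0 : 0 <= t by exact: powR_ge0.
have t1 : t <= 1 by exact: maximizer_le1.
have base (h : R) : 0 < h -> 0 < 1 + (h `^ p - 1) * t.
  move=> h0; have hp : 0 < h `^ p by exact: powR_gt0.
  have [->|tN1] := eqVneq t 1; first by lra.
  have : t < 1 by rewrite lt_neqAle tN1.
  have : 0 <= h `^ p * t by rewrite mulr_ge0// ltW.
  by lra.
pose f (h : R) := L * (1 + (h `^ p - 1) * t) `^ (s%:R / p)
                  - (L + (h - 1) * linkQ v x).
have fge0 (h : R) : 0 < h -> 0 <= f h.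
  move=> h0; rewrite /f subr_ge0 -xl -PQ_scale_at.
  by apply: le_trans (PQ_le_lambdaQ _) _; rewrite sum_scale_at ?(ltW h0)// x1 xl.
have f1 : f 1 = 0 by rewrite /f powR1 subrr !mul0r !addr0 powR1 mulr1 subrr.
have df (h : R) : 0 < h -> is_derive h 1 f
   (L * ((s%:R / p) * (1 + (h `^ p - 1) * t) `^ (s%:R / p - 1) * (p * h `^ (p - 1) * t)) - linkQ v x).
  move=> h0; pose g (k : R) := 1 + (k `^ p - 1) * t.
  have dg : is_derive h 1 g (p * h `^ (p - 1) * t).
    have dp := is_derive1_powR p h0.
    rewrite /g; apply: is_derive_eq.
    by rewrite /GRing.scale/=; ring.
  have dG := @is_derive1_comp R (fun z : R => z `^ (s%:R / p)) g _ _ _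
    (is_derive1_powR (s%:R / p) (base h h0)) dg.
  have -> : f = (fun k => L * ((fun z : R => z `^ (s%:R / p)) \o g) k
                          - (L + (k - 1) * linkQ v x)) by [].
  apply: is_derive_eq.
  by rewrite /GRing.scale/=; ring.
(* Since [f 1 = 0] and [f] is nonnegative on the positive axis, 1 is an interior minimum on []0,
   2[]. *)
have d0 : is_derive (1 : R) 1 f 0.
  apply: (@derive1_at_min _ f 0 2); rewrite ?in_itv/= ?ltr01 ?ltr1n//.
    by move=> u; rewrite in_itv/= => /andP[u0 _]; have [] := df u u0.
  by move=> u; rewrite in_itv/= => /andP[u0 _]; rewrite f1 fge0.
have := df 1 ltr01; rewrite powR1 subrr mul0r addr0 !powR1 => -[_ d1].
case: d0 => _ d0; move: d1; rewrite d0 => /esym/eqP.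
rewrite subr_eq0 => /eqP <-; field; exact: lt0r_neq0.
Qed.

End maximizer.

(** * Attained suprema and the effect of deleting a vertex *)

Lemma sup_finite_attained (R : realType) (T : finType) (f : T -> R) (C : set T) :
  (C !=set0)%classic -> exists2 H, C H & f H = sup [set f x | x in C]%classic.
Proof.
move=> [H0 CH0].
have PH0 : `[< C H0 >] by apply/asboolP.
case: (@arg_maxP _ _ T H0 (fun H => `[< C H >]) f PH0) => H /asboolP CH Hmax; exists H => //.
have ub : ubound [set f x | x in C]%classic (f H).
  by move=> _ [x Cx <-]; apply: Hmax; exact/asboolP.
apply/eqP; rewrite eq_le; apply/andP; split.
  by apply: ub_le_sup; [exists (f H)|exists H].
by apply: ge_sup => //; exists (f H), H.
Qed.

Lemma le_sup_finite (R : realType) (T : finType) (f : T -> R) (C : set T) H :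
  C H -> f H <= sup [set f x | x in C]%classic.
Proof.
move=> CH; apply: ub_le_sup; last by exists H.
exists (\sum_x `|f x|) => _ [x _ <-].
rewrite (bigD1 x)//= (le_trans (ler_norm _))// lerDl.
by apply: sumr_ge0 => i _.
Qed.

Lemma lambda_class_ge0 (R : realType) (p : R) (s n : nat) (Q : {set {set 'I_s}})
  (C : set {set {set 'I_n}}) : 1 < p -> 0 <= lambda_class p Q C.
Proof.
move=> p1; have [->|C0] := eqVneq C classical_sets.set0.
  by rewrite /lambda_class image_set0 sup0.
rewrite /lambda_class; have /set0P/(sup_finite_attained (lambdaQ p Q))[H _ <-] := C0.
exact: lambdaQ_ge0.
Qed.

(** With the coordinate at [v] set to 0 only the [s]-sets avoiding [v] contribute, and these are the
    images under [lift v] of the [s]-sets of the smaller vertex set. *)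
Lemma PQ_delete (R : realType) (s m : nat) (Q : {set {set 'I_s}})
  (H : {set {set 'I_m.+1}}) (v : 'I_m.+1) (x : 'I_m.+1 -> R) :
  (forall i, 0 <= x i) ->
  PQ Q H (scale_at v 0 x) <=
  PQ Q [set e : {set 'I_m} | lift v @: e \in H] (fun i => x (lift v i)).
Proof.
move=> x0; rewrite /PQ ler_wpM2l//.
rewrite (bigID (fun I : {set 'I_m.+1} => v \in I))/= big1 ?add0r; last first.
  by move=> I /andP[_ vI]; rewrite (bigD1 v)//= /scale_at eqxx !mul0r mulr0.
have liftK (I : {set 'I_m.+1}) : v \notin I -> lift v @: (lift v @^-1: I) = I.
  move=> vI; apply/setP => i; apply/imsetP/idP => [[j + ->]|iI].
    by rewrite inE.
  have /unlift_some[j ij _] : v != i by apply: contraNneq vI => ->.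
  by exists j => //; rewrite inE -ij.
rewrite (reindex_onto (fun I : {set 'I_m} => lift v @: I)
  (fun I : {set 'I_m.+1} => lift v @^-1: I))/=; last first.
  by move=> I /andP[_ vI]; exact: liftK.
rewrite [leLHS](eq_bigl (fun I : {set 'I_m} => #|I| == s)); last first.
  move=> I; rewrite card_imset; last exact: lift_inj.
  case: (#|I| == s) => //=; apply/andP; split.
    by apply/imsetP => -[j _]; move/eqP; rewrite (negbTE (neq_lift _ _)).
  by apply/eqP/setP => j; rewrite inE mem_imset//; exact: lift_inj.
apply: ler_sum => I _; rewrite big_imset/=; last by move=> i j _ _ /lift_inj.
under eq_bigr => i _ do rewrite /scale_at eq_sym (negbTE (neq_lift _ _)).
by rewrite ler_wpM2r ?prodr_ge0// ler_nat NQI_lift_le.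
Qed.

(** Take [h = 0] in the variation of the coordinate at [v], with [t] its [p]-th power: by Lagrange's
    condition the value left is [lambda (1 - s t)], and the other [p]-th powers sum to [1 - t]. *)
Lemma deletion_bound (R : realType) (p : R) (r s m : nat) (Q : {set {set 'I_s}})
  (F : forall m : nat, {set {set 'I_m}} -> Prop) (H : {set {set 'I_m.+1}})
  (x : 'I_m.+1 -> R) (v : 'I_m.+1) :
  1 < p -> (0 < s)%N -> Ffree_class r F m.+1 H -> maximizer p Q H x ->
  lambdaQ p Q H * (1 - s%:R * x v `^ p) <=
  lambda_class p Q (Ffree_class r F m) * (1 - x v `^ p) `^ (s%:R / p).
Proof.
move=> p1 s0 FH xmax; have [x0 x1 xl] := xmax.
have := PQ_delete Q H v x0.
rewrite PQ_scale_at (maximizer_linkQ p1 s0 v xmax) xl sub0r mulN1r => H1.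
apply: (@le_trans _ _ (lambdaQ p Q H - s%:R * lambdaQ p Q H * x v `^ p)).
  by rewrite le_eqVlt; apply/orP; left; apply/eqP; ring.
apply: le_trans H1 _; apply: le_trans (PQ_le_lambdaQ _ _ p1 s0 _) _.
have -> : \sum_i `|x (lift v i)| `^ p = 1 - x v `^ p.
  rewrite -x1 (bigD1_ord v)//= [RHS]addrAC subrr add0r.
  by apply: eq_bigr => i _; rewrite ger0_norm.
rewrite ler_wpM2r ?powR_ge0//.
exact/(le_sup_finite (lambdaQ p Q))/Ffree_class_delete.
Qed.

(** * Consequences of an almost uniform maximizer *)

(** Sets through [v] are written [v |: J]; weight 0 for the [J] containing [v] lets the sum run over
    all [(k-1)]-sets, the form that [near_uniform_sum_le] takes. *)
Lemma sum_subsets_containing (R : realDomainType) (n k : nat) (v : 'I_n)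
  (f : {set 'I_n} -> R) : (0 < k)%N ->
  \sum_(I : {set 'I_n} | (#|I| == k) && (v \in I)) f I =
  \sum_(J : {set 'I_n} | #|J| == k.-1) (if v \in J then 0 else f (v |: J)%SET).
Proof.
case: k => // k _; rewrite (reindex_onto (fun J : {set 'I_n} => (v |: J)%SET)
  (fun I : {set 'I_n} => (I :\ v)%SET))/=; last first.
  by move=> I /andP[_ vI]; exact: finset.setD1K.
rewrite [RHS](bigID (fun J : {set 'I_n} => v \in J))/= [X in _ = X + _]big1 ?add0r; last first.
  by move=> J /andP[_ ->].
rewrite [RHS](eq_bigr (fun J => f (v |: J)%SET)); last first.
  by move=> J /andP[_ /negbTE ->].
apply: eq_bigl => J; rewrite finset.setU11 andbT cardsU1.
case: (boolP (v \in J)) => vJ; rewrite ?andbF ?andbT.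
  apply/negP => /andP[_ /eqP JE]; move: vJ; rewrite -JE.
  by rewrite !inE eqxx.
by rewrite finset.setU1K// eqxx andbT.
Qed.

Section rescaled.
Context (R : realType) (p : R) (s n : nat).
Context (Q : {set {set 'I_s}}) (H : {set {set 'I_n}}) (x : 'I_n -> R).
Hypothesis p1 : 1 < p.
Hypothesis s0 : (0 < s)%N.
Hypothesis n0 : (0 < n)%N.
Hypothesis xmax : maximizer p Q H x.
Let p0 : 0 < p. Proof. exact: lt_trans ltr01 p1. Qed.
(** Scaled so that the [p]-th powers average 1: a uniform maximizer becomes the all-one vector. *)
Let y i := n%:R `^ p^-1 * x i.

Let y0 i : 0 <= y i.
Proof. by have [x0 _ _] := xmax; rewrite mulr_ge0 ?powR_ge0. Qed.

Let y_powR i : y i `^ p = n%:R * x i `^ p.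
Proof.
have [x0 _ _] := xmax.
by rewrite powRM ?powR_ge0// -powRrM mulVf ?lt0r_neq0// powRr1.
Qed.

Let sum_y : \sum_i y i `^ p = n%:R.
Proof.
have [_ x1 _] := xmax; under eq_bigr do rewrite y_powR.
by rewrite -mulr_sumr x1 mulr1.
Qed.

Let scale_expr : (n%:R `^ p^-1) ^+ s = n%:R `^ (s%:R / p) :> R.
Proof. by rewrite -powR_mulrn ?powR_ge0// -powRrM mulrC. Qed.

Let PQ_y : PQ Q H y = lambdaQ p Q H * n%:R `^ (s%:R / p).
Proof. by have [_ _ <-] := xmax; rewrite PQ_homogeneous scale_expr mulrC. Qed.

Lemma lambdaQ_le_fact : lambdaQ p Q H * n%:R `^ (s%:R / p) <= s`!%:R * n%:R ^+ s.
Proof.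
rewrite -PQ_y; apply: le_trans (PQ_le_sum_expr _ _ _) _ => //.
have sumy : \sum_i y i <= n%:R by apply: sum_le_of_sum_powR_le p1 _ _; rewrite ?sum_y.
by rewrite ler_wpM2l// lerXn2r ?nnegrE ?sumr_ge0 ?ler0n.
Qed.

Section near_uniform.
Context (d : R).
Hypothesis d0 : 0 <= d.
Hypothesis d1 : d <= 1.
Hypothesis xd : forall i, 1 - d <= n%:R * x i `^ p.

(** The near-uniform estimate compares [PQ] at [y] with its value at the all-one vector, which is s!
    times the number of copies. The error is small against [n ^+ s] when [d] is small and [n]
    large. *)
Lemma lambdaQ_le_near_uniform :
  lambdaQ p Q H * n%:R `^ (s%:R / p) <=
  s`!%:R * ((NQ Q H)%:R
   + s`!%:R * (n%:R ^+ s / s`!%:R - (1 - s%:R * d) * 'C(n, s)%:R)).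
Proof.
rewrite -PQ_y /PQ ler_wpM2l// /NQ natr_sum.
apply: (near_uniform_sum_le p1 d0 d1 _ y0); rewrite ?sum_y//.
  by move=> i; rewrite y_powR.
by move=> J cJ; rewrite ler0n ler_nat NQI_le_fact.
Qed.

(** Lagrange's condition at [v] expresses the link sum through [lambda] and the [p]-th power of
    [y v]; dividing by [y v] leaves a sum over [(s-1)]-sets, which at the all-one vector is the
    [Q]-degree of [v]. *)
Lemma degQ_ge_near_uniform (v : 'I_n) : d < 1 ->
  lambdaQ p Q H * n%:R `^ (s%:R / p) * (1 - d) <=
  n%:R * (s.-1)`!%:R * ((degQ Q H v)%:R
   + s`!%:R * (n%:R ^+ s.-1 / (s.-1)`!%:R
               - (1 - (s.-1)%:R * d) * 'C(n, s.-1)%:R)).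
Proof.
move=> dlt1.
have nr0 : 0 < n%:R :> R by rewrite ltr0n.
(* Either [y v >= 1], where raising to the power [p] does not decrease it, or [y v < 1] and its
   power is still at least [1 - d]. *)
have yv : (1 - d) * y v <= y v `^ p.
  have [y1|y1] := leP 1 (y v).
    apply: le_trans (le1r_powR y1 (ltW p1)).
    by rewrite ler_piMl// lerBlDr lerDl.
  apply: (@le_trans _ _ (1 - d)); last by rewrite y_powR.
  by rewrite ler_piMr ?subr_ge0// ltW.
have yv0 : 0 < y v.
  rewrite lt_def y0 andbT; apply: contraTneq (xd v) => yv0.
  by rewrite -y_powR yv0 powR0 ?lt0r_neq0// -ltNge subr_gt0.
pose w (J : {set 'I_n}) : R := if v \in J then 0 else (NQI Q H (v |: J)%SET)%:R.
pose S := \sum_(J : {set 'I_n} | #|J| == s.-1) w J * \prod_(i in J) y i.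
have linkE : linkQ Q H v y = s`!%:R * (y v * S).
  rewrite /linkQ sum_subsets_containing//; congr (_ * _).
  rewrite /S mulr_sumr; apply: eq_bigr => J _; rewrite /w.
  by case: ifPn => vJ; rewrite ?mul0r ?mulr0// big_setU1//= mulrCA.
have link_y : linkQ Q H v y = n%:R `^ (s%:R / p) * linkQ Q H v x.
  rewrite /linkQ [RHS]mulrCA; congr (_ * _); rewrite mulr_sumr.
  apply: eq_bigr => I /andP[/eqP cI _].
  by rewrite big_split/= prodr_const cI scale_expr mulrCA.
have SE : n%:R * (s.-1)`!%:R * S * y v =
    lambdaQ p Q H * n%:R `^ (s%:R / p) * y v `^ p.
  have := linkE; rewrite link_y (maximizer_linkQ p1 s0 v xmax) => E.
  have sr0 : s%:R != 0 :> R by rewrite pnatr_eq0 -lt0n.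
  apply: (mulfI sr0); rewrite y_powR.
  have sfE : s`!%:R = s%:R * (s.-1)`!%:R :> R.
    by rewrite -natrM -{1 2}(prednK s0) factS.
  move: E; rewrite sfE => E.
  have -> : s%:R * (n%:R * (s.-1)`!%:R * S * y v)
          = n%:R * (s%:R * (s.-1)`!%:R * (y v * S)) by ring.
  by rewrite -E; ring.
have S_le : S <= (degQ Q H v)%:R
   + s`!%:R * (n%:R ^+ s.-1 / (s.-1)`!%:R - (1 - (s.-1)%:R * d) * 'C(n, s.-1)%:R).
  have -> : (degQ Q H v)%:R = \sum_(J : {set 'I_n} | #|J| == s.-1) w J.
    by rewrite /degQ natr_sum sum_subsets_containing.
  apply: (near_uniform_sum_le p1 d0 d1 _ y0); rewrite ?sum_y//.
    by move=> i; rewrite y_powR.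
  move=> J cJ; rewrite /w; case: ifPn => vJ; first by rewrite lexx ler0n.
  by rewrite ler0n ler_nat NQI_le_fact// cardsU1 vJ cJ add1n prednK.
apply: le_trans (ler_wpM2l _ S_le); last by rewrite mulr_ge0.
rewrite -(ler_pM2r yv0) SE -[leLHS]mulrA ler_wpM2l// mulr_ge0 ?powR_ge0//.
exact: lambdaQ_ge0.
Qed.

End near_uniform.
End rescaled.

(** The all-one vector serves as test vector. *)
Lemma NQ_le_lambdaQ (R : realType) (p : R) (s n : nat) (Q : {set {set 'I_s}})
  (H : {set {set 'I_n}}) : 1 < p -> (0 < s)%N ->
  s`!%:R * (NQ Q H)%:R <= lambdaQ p Q H * n%:R `^ (s%:R / p).
Proof.
move=> p1 s0; have := PQ_le_lambdaQ Q H p1 s0 (fun=> 1).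
under eq_bigr do rewrite normr1 powR1.
rewrite sumr_const card_ord; apply: le_trans.
rewrite /PQ /NQ natr_sum ler_wpM2l//; apply: ler_sum => I _.
by rewrite big1 ?mulr1.
Qed.

(** * Binomial estimates and slowly decreasing sequences *)

Lemma ffact_le_expn (n k : nat) : (n ^_ k <= n ^ k)%N.
Proof.
elim: k n => [|k IH] [|n]; rewrite ?ffactn0 ?expn0// ?ffact0n//.
rewrite ffactSS expnS leq_mul2l (leq_trans (IH n))//.
by case: k {IH} => // k; rewrite leq_exp2r.
Qed.

Lemma expn_le_ffact (n k : nat) : ((n - k) ^ k <= n ^_ k)%N.
Proof.
rewrite ffact_prod -{2}(card_ord k) -prod_nat_const.
by apply: leq_prod => i _; rewrite leq_sub2l// ltnW.
Qed.

Lemma bin_le_expr (R : realType) (n k : nat) :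
  'C(n, k)%:R <= n%:R ^+ k / k`!%:R :> R.
Proof.
rewrite ler_pdivlMr ?ltr0n ?fact_gt0// -natrM bin_ffact -natrX ler_nat.
exact: ffact_le_expn.
Qed.

(** The falling factorial is at least [(n - k) ^ k], and Bernoulli's inequality applies to
    [(1 - k / n) ^ k]. *)
Lemma bin_ge_expr (R : realType) (n k : nat) : (0 < n)%N -> (k <= n)%N ->
  (1 - k%:R * (k%:R / n%:R)) * (n%:R ^+ k / k`!%:R) <= 'C(n, k)%:R :> R.
Proof.
move=> n0 kn; have nr0 : 0 < n%:R :> R by rewrite ltr0n.
rewrite [leLHS]mulrA ler_pdivrMr ?ltr0n ?fact_gt0// -natrM bin_ffact.
apply: (@le_trans _ _ ((n%:R - k%:R) ^+ k)); last first.
  by rewrite -natrB// -natrX ler_nat expn_le_ffact.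
have -> : n%:R - k%:R = n%:R * (1 - k%:R / n%:R) :> R by field; rewrite gt_eqF.
rewrite exprMn mulrC ler_wpM2l ?exprn_ge0//.
apply: expr_onem_Bernoulli; first by rewrite divr_ge0.
by rewrite ler_pdivrMr// mul1r ler_nat.
Qed.

(* Otherwise [d (2 ^ j * m)] decreases by at least [kappa / 2] at each doubling
   of the index. *)
Lemma slow_decrease (R : realType) (d : nat -> R) (kappa : R) (M : nat) :
  0 < kappa -> (forall n, 0 <= d n) ->
  exists2 m, (M <= m)%N & d m < d m.+1 + kappa / m.+1%:R.
Proof.
move=> k0 dge0; apply: contrapT => noM.
have dec m : (M <= m)%N -> d m.+1 + kappa / m.+1%:R <= d m.
  by move=> Mm; rewrite leNgt; apply/negP => lt; apply: noM; exists m.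
have decj m j : (0 < m)%N -> (M <= m)%N ->
    d (m + j)%N + j%:R * (kappa / (m + j)%:R) <= d m.
  move=> m0 Mm; elim: j => [|j IH]; first by rewrite addn0 mul0r addr0.
  apply: le_trans IH; rewrite addnS.
  have H1 := dec _ (leq_trans Mm (leq_addr j m)).
  have H2 : j%:R * (kappa / (m + j).+1%:R) <= j%:R * (kappa / (m + j)%:R).
    rewrite ler_wpM2l// ler_wpM2l ?(ltW k0)//.
    by rewrite lef_pV2 ?posrE ?ltr0n ?addn_gt0 ?m0// ler_nat.
  rewrite -[j.+1%:R]natr1 mulrDl mul1r; move: H1 H2.
  set a := kappa / _; set c := j%:R * (_ / _); set e := j%:R * _.
  by lra.
have dec2 m : (0 < m)%N -> (M <= m)%N -> d (m + m)%N + kappa / 2 <= d m.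
  move=> m0 Mm; apply: le_trans (decj m m m0 Mm); rewrite lerD2l natrD.
  have mr0 : 0 < m%:R :> R by rewrite ltr0n.
  rewrite le_eqVlt; apply/orP; left; apply/eqP; field.
  by rewrite -mulr2n mulrn_eq0/= gt_eqF.
have dec2j j : d (M.+1 * 2 ^ j)%N + j%:R * (kappa / 2) <= d M.+1.
  elim: j => [|j IH]; first by rewrite muln1 mul0r addr0.
  apply: le_trans IH.
  have := dec2 (M.+1 * 2 ^ j)%N.
  rewrite muln_gt0 expn_gt0/= => /(_ isT).
  have -> : (M <= M.+1 * 2 ^ j)%N.
    by rewrite (leq_trans (leqnSn M))// leq_pmulr// expn_gt0.
  move=> /(_ isT); rewrite addnn -muln2 -mulnA -expnSr -natr1 => h.
  by lra.
(* Enough doublings for the accumulated drop to exceed the starting value, against nonnegativity. *)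
pose j := Num.bound (d M.+1 / (kappa / 2)).
have := dec2j j; rewrite leNgt => /negP; apply.
apply: (@lt_le_trans _ _ (j%:R * (kappa / 2))); last by rewrite lerDr.
rewrite -ltr_pdivrMr ?divr_gt0//.
by apply: archi_boundP; rewrite !divr_ge0// ltW.
Qed.

Lemma eventually_divn_le (R : realType) (c e : R) : 0 < e ->
  exists M : nat, forall n, (M <= n)%N -> c / n%:R <= e.
Proof.
move=> e0; exists (Num.bound `|c / e|).+1 => n Mn.
have nr0 : 0 < n%:R :> R by rewrite ltr0n (leq_trans _ Mn).
rewrite ler_pdivrMr// mulrC -ler_pdivrMr//.
apply: le_trans (ler_norm _) _; apply: ltW; apply: lt_le_trans (archi_boundP _) _.
  exact: normr_ge0.
by rewrite ler_nat ltnW.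
Qed.

(** * Near-monotonicity of the normalized spectral value *)

Section asymptotics.
Context (R : realType) (p : R) (r s : nat) (Q : {set {set 'I_s}}).
Context (F : forall m : nat, {set {set 'I_m}} -> Prop).
Hypothesis p1 : 1 < p.
Hypothesis s0 : (0 < s)%N.
Let p0 : 0 < p. Proof. exact: lt_trans ltr01 p1. Qed.
Let sr0 : 0 < s%:R :> R. Proof. by rewrite ltr0n. Qed.
Let ell n := lambda_class p Q (Ffree_class r F n).
Let rho : R := s%:R - s%:R / p.
(** Quadratic coefficient in [(1 - s t) (1 + (s/p) t) = 1 - rho t - C t^2]. *)
Let C : R := s%:R * (s%:R / p).
Let sp0 : 0 < s%:R / p. Proof. exact: divr_gt0. Qed.

Let rho_gt0 : 0 < rho.
Proof. by rewrite subr_gt0 ltr_pdivrMr// ltr_pMr. Qed.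

Let C_gt0 : 0 < C.
Proof. by rewrite mulr_gt0. Qed.

Lemma powR_rho n : (0 < n)%N -> n%:R `^ rho * n%:R `^ (s%:R / p) = n%:R ^+ s.
Proof.
move=> n0; rewrite -powRD; last by rewrite pnatr_eq0 -lt0n n0 implybT.
by rewrite /rho subrK powR_mulrn.
Qed.

(** Multiplying the deletion bound by [1 + (s/p) t] cancels the real power, by Bernoulli's
    inequality with exponent [s/p]. *)
Lemma lambdaQ_le_deletion (m : nat) (H : {set {set 'I_m.+1}}) x v :
  Ffree_class r F m.+1 H -> maximizer p Q H x -> x v `^ p < 1 ->
  lambdaQ p Q H * (1 - rho * x v `^ p - C * x v `^ p ^+ 2) <= ell m.
Proof.
move=> FH xmax; set t := x v `^ p => t1.
have t0 : 0 <= t by exact: powR_ge0.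
have := deletion_bound v p1 s0 FH xmax; rewrite -/t -/(ell m) => H1.
have at0 : 0 <= 1 + s%:R / p * t by rewrite addr_ge0// mulr_ge0// ltW.
have := ler_wpM2r at0 H1.
have -> : lambdaQ p Q H * (1 - s%:R * t) * (1 + s%:R / p * t) =
    lambdaQ p Q H * (1 - rho * t - C * t ^+ 2) by rewrite /rho /C; ring.
move=> /le_trans; apply; rewrite -[leLHS]mulrA ler_piMr//.
  exact: lambda_class_ge0.
by apply: powR_onem_Bernoulli => //; exact: ltW.
Qed.

Let density n : R := ell n / n%:R `^ rho.
(** Bounds, for [th] and [u] in [[0, 1]], the terms of order two and more in
    [(1 - rho th u - C u^2) (1 + rho u)]. *)
Let K : R := C + rho ^+ 2 + C * rho.

Let density_ge0 n : 0 <= density n.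
Proof. by rewrite divr_ge0 ?powR_ge0//; exact: lambda_class_ge0. Qed.

Let n_rho_gt0 n : (0 < n)%N -> 0 < n%:R `^ rho :> R.
Proof. by move=> n0; rewrite powR_gt0// ltr0n. Qed.

(** A gain [1 + rho / n] comes from comparing the [rho]-th powers of [m] and [m.+1]. With [th = 1],
    the least coordinate gives monotonicity; with [th < 1], a coordinate below average gives a drop
    of order [1/n]. *)
Lemma deletion_step (m : nat) (H : {set {set 'I_m.+1}}) x v (th : R) :
  (0 < m)%N -> 0 <= th -> th <= 1 ->
  Ffree_class r F m.+1 H -> lambdaQ p Q H = ell m.+1 -> maximizer p Q H x ->
  x v `^ p <= th / m.+1%:R ->
  density m.+1 * (1 + rho * (1 - th) / m.+1%:R - K / m.+1%:R ^+ 2) <= density m.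
Proof.
move=> m0 th0 th1 FH Hl xmax xv.
set n := m.+1%:R; have n2 : 2 <= n :> R by rewrite ler_nat.
have ngt0 : 0 < n by lra.
set t := x v `^ p in xv; have t0 : 0 <= t by exact: powR_ge0.
pose u : R := n^-1; have u0 : 0 < u by rewrite invr_gt0.
have u1 : u <= 1 / 2 by rewrite /u -[n^-1]mul1r ler_pdivrMr//; lra.
rewrite -/u in xv.
have tu : t <= u by apply: le_trans xv _; rewrite ler_piMl// ltW.
have t1 : t < 1 by lra.
have := lambdaQ_le_deletion FH xmax t1; rewrite -/t Hl => H1.
have ell0 : 0 <= ell m.+1 by exact: lambda_class_ge0.
have H2 : ell m.+1 * (1 - rho * th * u - C * u ^+ 2) <= ell m.
  apply: le_trans H1; rewrite ler_wpM2l//.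
  have : rho * t <= rho * (th * u) by rewrite ler_wpM2l// ltW.
  have : C * t ^+ 2 <= C * u ^+ 2.
    by rewrite ler_wpM2l ?(ltW C_gt0)// lerXn2r// nnegrE ltW.
  by lra.
have H3 : (1 - u) `^ rho * (1 + rho * u) <= 1.
  by apply: powR_onem_Bernoulli; [exact: ltW|lra].
have mE : m%:R = n * (1 - u).
  by rewrite mulrBr mulr1 divff ?gt_eqF// /n -natr1 addrK.
have u1p : 0 < 1 - u by lra.
rewrite /density mE powRM ?(ltW ngt0) ?(ltW u1p)// -/n.
have nr : 0 < n `^ rho by rewrite powR_gt0.
have ur : 0 < (1 - u) `^ rho by rewrite powR_gt0.
rewrite ler_pdivlMr ?mulr_gt0//.
have -> : ell m.+1 / n `^ rho * (1 + rho * (1 - th) / n - K / n ^+ 2) *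
    (n `^ rho * (1 - u) `^ rho) =
    ell m.+1 * (1 + rho * (1 - th) / n - K / n ^+ 2) * (1 - u) `^ rho.
  by field; rewrite !gt_eqF.
apply: (@le_trans _ _ (ell m * ((1 - u) `^ rho * (1 + rho * u)))); last first.
  by rewrite ler_piMr//; exact: lambda_class_ge0.
rewrite [(1 - u) `^ rho * _]mulrC mulrA ler_wpM2r ?(ltW ur)//.
apply: le_trans (ler_wpM2r _ H2); last by rewrite addr_ge0// mulr_ge0 ?(ltW rho_gt0) ?(ltW u0).
rewrite -[leRHS]mulrA ler_wpM2l// -exprVn -/u /K.
have : 0 <= rho ^+ 2 * (1 - th) * u ^+ 2.
  by rewrite mulr_ge0 ?sqr_ge0// mulr_ge0 ?sqr_ge0// subr_ge0.
have : 0 <= C * rho * u ^+ 2 * (1 - u).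
  by rewrite mulr_ge0 ?(ltW u1p)// mulr_ge0 ?sqr_ge0// mulr_ge0// ltW.
by lra.
Qed.


Lemma maximizer_min_entry (n : nat) (H : {set {set 'I_n}}) x : (0 < n)%N ->
  maximizer p Q H x -> exists v, n%:R * x v `^ p <= 1.
Proof.
case: n H x => // n H x _ [_ x1 _].
case: (@arg_minP _ _ 'I_n.+1 ord0 predT (fun i => x i `^ p) isT) => v _ vmin.
exists v; rewrite -[leRHS]x1 mulr_natl -[n.+1 in leLHS]card_ord -sumr_const.
by apply: ler_sum => i _; exact: vmin.
Qed.

Let density_expn n : (0 < n)%N -> density n * n%:R ^+ s = ell n * n%:R `^ (s%:R / p).
Proof.
move=> n0; rewrite -powR_rho// mulrA; congr (_ * _).
by rewrite /density mulfVK// gt_eqF// n_rho_gt0.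
Qed.

Let ell_attained n : (Ffree_class r F n !=set0)%classic ->
  exists2 H, Ffree_class r F n H & lambdaQ p Q H = ell n.
Proof. exact: sup_finite_attained. Qed.

Lemma density_le_fact n : (0 < n)%N -> (Ffree_class r F n !=set0)%classic ->
  density n <= s`!%:R.
Proof.
move=> n0 /ell_attained[H _ Hl].
have [x xmax] := maximizer_exists Q H p1 n0.
have nr0 : 0 < n%:R ^+ s :> R by rewrite exprn_gt0// ltr0n.
by rewrite -(ler_pM2r nr0) density_expn// -Hl (lambdaQ_le_fact p1 xmax).
Qed.

Let K' : R := K * s`!%:R.
Let K_ge0 : 0 <= K.
Proof.
have Cr : 0 < C * rho by exact: mulr_gt0.
by have := sqr_ge0 rho; rewrite /K; have := C_gt0; lra.
Qed.

Let K'_ge0 : 0 <= K'.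
Proof. exact: mulr_ge0. Qed.

(* The term [K' / n] absorbs the [O(1/n^2)] loss in [deletion_step]. *)
Let corrected_density n : R := density n + K' / n%:R.

Lemma corrected_density_step (m : nat) (H : {set {set 'I_m.+1}}) x v (th : R) :
  (0 < m)%N -> 0 <= th -> th <= 1 ->
  Ffree_class r F m.+1 H -> lambdaQ p Q H = ell m.+1 -> maximizer p Q H x ->
  m.+1%:R * x v `^ p <= th ->
  corrected_density m.+1 + rho * (1 - th) * density m.+1 / m.+1%:R <= corrected_density m.
Proof.
move=> m0 th0 th1 FH Hl xmax xv.
have mr0 : 0 < m%:R :> R by rewrite ltr0n.
have nr0 : 0 < m.+1%:R :> R by rewrite ltr0n.
have := deletion_step m0 th0 th1 FH Hl xmax (v := v).
rewrite ler_pdivlMr// mulrC => /(_ xv) H1.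
have bs : density m.+1 <= s`!%:R by apply: density_le_fact => //; exists H.
have H2 : K * density m.+1 / m.+1%:R ^+ 2 <= K' / m.+1%:R ^+ 2.
  by rewrite ler_wpM2r ?invr_ge0 ?exprn_ge0// /K' ler_wpM2l.
(* With [n = m.+1], [1/n^2 <= 1/m - 1/n], so the quadratic loss telescopes. *)
have H3 : K' / m.+1%:R ^+ 2 <= K' / m%:R - K' / m.+1%:R.
  have -> : K' / m%:R - K' / m.+1%:R = K' / (m%:R * m.+1%:R).
    by rewrite -natr1; field; rewrite natr1 !gt_eqF.
  rewrite ler_wpM2l// lef_pV2 ?posrE ?mulr_gt0 ?exprn_gt0//.
  by rewrite expr2 ler_wpM2r// ler_nat.
have H4 : density m.+1 * (1 + rho * (1 - th) / m.+1%:R - K / m.+1%:R ^+ 2) =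
  density m.+1 + rho * (1 - th) * density m.+1 / m.+1%:R - K * density m.+1 / m.+1%:R ^+ 2.
  by field; rewrite gt_eqF.
move: H1 H2 H3; rewrite H4 /corrected_density.
move: (K * _ / _) (rho * _ * _ / _) (K' / m.+1%:R ^+ 2) (K' / m%:R) (K' / m.+1%:R).
move: (density _) (density _) => a1 a2 a3 a4 a5 a6 a7 h1 h2 h3.
by lra.
Qed.

Let corrected_density_ge0 n : 0 <= corrected_density n.
Proof. by rewrite addr_ge0// divr_ge0. Qed.

Lemma corrected_density_nonincreasing (m n : nat) : (0 < m)%N -> (m <= n)%N ->
  (forall k, (m <= k)%N -> (Ffree_class r F k !=set0)%classic) ->
  corrected_density n <= corrected_density m.
Proof.
move=> m0 mn Fk; elim: n mn => [|n IH]; first by rewrite leqn0 => /eqP->.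
rewrite leq_eqVlt => /predU1P[<-//|]; rewrite ltnS => mn.
apply: le_trans (IH mn).
have [H FH Hl] := ell_attained (Fk _ (leqW mn)).
have [x xmax] := maximizer_exists Q H p1 (ltn0Sn n).
have [v xv] := maximizer_min_entry (ltn0Sn n) xmax.
have := corrected_density_step (leq_trans m0 mn) ler01 (lexx 1) FH Hl xmax xv.
by rewrite subrr mulr0 !mul0r addr0.
Qed.

(** Divide the near-uniform bound by [n ^+ s]; the two errors come from comparing ['C(n, s)] with
    n^s / s! and from the deviation [dl]. *)
Lemma density_le_near_uniform (n : nat) (H : {set {set 'I_n}}) x (dl : R) :
  (0 < n)%N -> (s <= n)%N -> 0 <= dl -> dl <= 1 ->
  Ffree_class r F n H -> lambdaQ p Q H = ell n -> maximizer p Q H x ->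
  (forall i, 1 - dl <= n%:R * x i `^ p) ->
  density n <= exQ R r Q F n / 'C(n, s)%:R
         + s`!%:R * (s%:R * (s%:R / n%:R) + s%:R * dl).
Proof.
move=> n0 sn dl0 dl1 FH Hl xmax xd.
have := lambdaQ_le_near_uniform p1 xmax dl0 dl1 xd.
rewrite Hl -density_expn// => H1.
have nr0 : 0 < n%:R :> R by rewrite ltr0n.
have sf0 : 0 < s`!%:R :> R by rewrite ltr0n fact_gt0.
have C1 := bin_le_expr R n s.
have C2 := @bin_ge_expr R n s n0 sn.
set A := n%:R ^+ s / s`!%:R in H1 C1 C2.
have A0 : 0 < A by rewrite divr_gt0// exprn_gt0.
have nA : n%:R ^+ s = s`!%:R * A by rewrite /A; field; rewrite gt_eqF.
move: H1; rewrite nA mulrCA ler_pM2l// => H1.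
have NQe : (NQ Q H)%:R <= exQ R r Q F n.
  exact: (le_sup_finite (fun H : {set {set 'I_n}} => (NQ Q H)%:R)).
set B := 'C(n, s)%:R in H1 C1 C2 *.
have B0 : 0 < B by rewrite ltr0n bin_gt0.
set g := exQ R r Q F n / B.
have eE : exQ R r Q F n = g * B by rewrite /g mulfVK// gt_eqF.
have g0 : 0 <= g by rewrite divr_ge0 ?(le_trans _ NQe)// ltW.
rewrite -(ler_pM2r A0); apply: le_trans H1 _.
rewrite [leRHS]mulrDl lerD//.
  by apply: le_trans NQe _; rewrite eE ler_wpM2l.
rewrite -[leRHS]mulrA ler_pM2l//.
have : s%:R * dl * B <= s%:R * dl * A by rewrite ler_wpM2l// mulr_ge0// ltW.
by lra.
Qed.

(** * Limit of the normalized spectral value *)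

Context (pi : R).
Hypothesis pi0 : 0 < pi.
Hypothesis exQ_cvg : ((fun n : nat => exQ R r Q F n / ('C(n, s))%:R) @ \oo --> pi)%classic.

Lemma eventually_exQ (e : R) : 0 < e ->
  exists M : nat, forall n, (M <= n)%N ->
    `|pi - exQ R r Q F n / 'C(n, s)%:R| < e.
Proof.
by move=> e0; have /cvgrPdist_lt /(_ e e0) [M _ HM] := exQ_cvg; exists M.
Qed.

(** An empty class makes [exQ] the supremum of the empty set, which is 0; for large [n] this is too
    far from [pi > 0]. *)
Lemma eventually_nonempty : exists M : nat, forall n, (M <= n)%N ->
  (Ffree_class r F n !=set0)%classic.
Proof.
have [M HM] := eventually_exQ pi0; exists M => n /HM.
have [F0|/set0P//] := eqVneq (Ffree_class r F n) classical_sets.set0.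
by rewrite /exQ F0 image_set0 sup0 mul0r subr0 gtr0_norm// ltxx.
Qed.

(** A graph with the most copies of [Q] is tested on the all-one vector; passing from ['C(n, s)] to
    n^s / s! costs a factor [1 - s^2 / n]. *)
Lemma eventually_density_ge (e : R) : 0 < e ->
  exists M : nat, forall n, (M <= n)%N -> pi - e <= density n.
Proof.
move=> e0; have e20 : 0 < e / 2 by rewrite divr_gt0.
have [M1 H1] := eventually_exQ e20.
have [M2 H2] := eventually_nonempty.
have [M3 H3] := @eventually_divn_le R ((pi + e / 2) * s%:R * s%:R) _ e20.
exists (maxn (maxn M1 M2) (maxn M3 s)) => n; rewrite !geq_max -!andbA.
move=> /and4P[/H1 G1 /H2 G2 /H3 G3 sn].
have n0 : (0 < n)%N by exact: leq_trans sn.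
have [|H FH HE] := @sup_finite_attained R _ (fun H : {set {set 'I_n}} => (NQ Q H)%:R)
  (Ffree_class r F n); first exact: G2.
have := NQ_le_lambdaQ Q H p1 s0.
have lH : lambdaQ p Q H <= ell n by exact: (le_sup_finite (lambdaQ p Q)).
move=> /le_trans /(_ (ler_wpM2r (powR_ge0 _ _) lH)).
rewrite -density_expn// => G4.
have nr0 : 0 < n%:R :> R by rewrite ltr0n.
have sf0 : 0 < s`!%:R :> R by rewrite ltr0n fact_gt0.
have C2 := @bin_ge_expr R n s n0 sn.
set A := n%:R ^+ s / s`!%:R in C2.
have A0 : 0 < A by rewrite divr_gt0// exprn_gt0.
have nA : n%:R ^+ s = s`!%:R * A by rewrite /A; field; rewrite gt_eqF.
move: G4; rewrite nA mulrCA ler_pM2l//.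
have -> : (NQ Q H)%:R = exQ R r Q F n :> R by exact: HE.
move: G1 C2; set B := 'C(n, s)%:R; set g := exQ R r Q F n / B => G1 C2.
have B0 : 0 < B by rewrite ltr0n bin_gt0.
have -> : exQ R r Q F n = g * B by rewrite /g mulfVK// gt_eqF.
have g0 : 0 <= g.
  by rewrite /g /exQ -HE divr_ge0// ltW.
move: G1; rewrite ltr_norml => /andP[G1a G1b] G4.
have G5 : g * ((1 - s%:R * (s%:R / n%:R)) * A) <= density n * A.
  by apply: le_trans G4; rewrite ler_wpM2l.
have {}G5 : g * (1 - s%:R * (s%:R / n%:R)) <= density n.
  by rewrite -(ler_pM2r A0) -mulrA.
apply: le_trans G5; move: G3; rewrite -[_ * _ * s%:R / _]mulrA -[leLHS]mulrA.
have : 0 <= s%:R * (s%:R / n%:R) :> R by rewrite mulr_ge0// divr_ge0.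
move: (s%:R * _) => z z0 G3.
have : g * z <= (pi + e / 2) * z by rewrite ler_wpM2r//; lra.
by lra.
Qed.

(** At an index where the corrected density drops by less than [kappa / n], no coordinate of the
    maximizer can be small, so the near-uniform bound applies; monotonicity carries it to all later
    indices. Four errors take [e / 4] each. *)
Lemma eventually_density_le (e : R) : 0 < e ->
  exists M : nat, forall n, (M <= n)%N -> density n <= pi + e.
Proof.
move=> e0; have e40 : 0 < e / 4 by rewrite divr_gt0.
have pi20 : 0 < pi / 2 by rewrite divr_gt0.
have sf0 : 0 < s`!%:R * s%:R :> R by rewrite mulr_gt0// ltr0n fact_gt0.
pose dl := Num.min 1 (e / 4 / (s`!%:R * s%:R)).
have dl0 : 0 < dl by rewrite lt_min ltr01 divr_gt0.
have dl1 : dl <= 1 by rewrite ge_min lexx.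
have sdl : s`!%:R * s%:R * dl <= e / 4.
  by rewrite mulrC -ler_pdivlMr// ge_min lexx orbT.
have [M1 H1] := eventually_exQ e40.
have [M2 H2] := eventually_nonempty.
have [M3 H3] := eventually_density_ge pi20.
have [M4 H4] := @eventually_divn_le R (s`!%:R * s%:R * s%:R) _ e40.
have [M5 H5] := @eventually_divn_le R K' _ e40.
pose M := maxn (maxn (maxn M1 M2) (maxn M3 M4)) (maxn M5 s).
(* This [kappa] is the drop, in units of [1/n], forced by a coordinate whose [p]-th power is at most
   [(1 - dl) / n], once the density is at least [pi / 2]. *)
have kp : 0 < rho * dl * (pi / 2) by rewrite !mulr_gt0.
have [m Mm dm] := slow_decrease M kp corrected_density_ge0.
have := leqW Mm; rewrite !geq_max => /andP[/andP[/andP[m1 m2]/andP[m3 m4]]/andP[m5 ms]].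
have m0 : (0 < m)%N.
  by move: Mm; rewrite !geq_max => /andP[_ /andP[_ sm]]; exact: leq_trans sm.
have [H FH Hl] := ell_attained (H2 _ m2).
have [x xmax] := maximizer_exists Q H p1 (ltn0Sn m).
have nr0 : 0 < m.+1%:R :> R by rewrite ltr0n.
have xd i : 1 - dl <= m.+1%:R * x i `^ p.
  rewrite leNgt; apply/negP => /ltW xi.
  have dl1' : 0 <= 1 - dl by rewrite subr_ge0.
  have dl1'' : 1 - dl <= 1 by rewrite lerBlDr lerDl ltW.
  have := corrected_density_step m0 dl1' dl1'' FH Hl xmax xi.
  rewrite subKr leNgt => /negP; apply.
  apply: lt_le_trans dm _; rewrite lerD2l ler_wpM2r ?invr_ge0//.
  by rewrite ler_wpM2l ?mulr_ge0 ?(ltW rho_gt0) ?(ltW dl0)//; have := H3 _ m3; lra.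
have := density_le_near_uniform (ltn0Sn m) ms (ltW dl0) dl1 FH Hl xmax xd.
have := H1 _ m1; rewrite ltr_norml => /andP[g1 _].
have := H4 _ m4; have := H5 _ m5.
rewrite mulrDr !mulrA => h5 h4 bm.
exists m.+1 => n mn.
have dn : corrected_density n <= corrected_density m.+1.
  by apply: corrected_density_nonincreasing => // k mk; apply: H2; exact: leq_trans mk.
have bd : density n <= corrected_density n by rewrite lerDl divr_ge0.
apply: le_trans bd _; apply: le_trans dn _; rewrite /corrected_density.
move: g1 h5 h4 bm sdl.
move: (exQ _ _ _ _ _ / _) => a1; move: (K' / m.+1%:R) => a2.
move: (s`!%:R * s%:R * s%:R / _) => a3; move: (_ * dl) => a4; move: (density _) => a5.
by lra.
Qed.

(** Keeps the deviation [dl] below 1 in the degree bound. *)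
Lemma pi_le_fact : pi <= s`!%:R.
Proof.
rewrite leNgt; apply/negP => pis.
have e0 : 0 < (pi - s`!%:R) / 2 by rewrite divr_gt0// subr_gt0.
have [M1 H1] := eventually_density_ge e0; have [M2 H2] := eventually_nonempty.
have := H1 (M1 + M2).+1 (leqW (leq_addr _ _)).
have := density_le_fact (ltn0Sn _) (H2 (M1 + M2).+1 (leqW (leq_addl _ _))).
by lra.
Qed.

(** * From the growth hypothesis to large minimum [Q]-degree *)

(** Growth bounds [ell m.+1 - ell m] from below; deleting the vertex of least [p]-th power [t]
    bounds it above by [ell m.+1 (rho t + C t^2)]. As the density is at most [pi (1 + e/2)],
    dividing by [pi rho n^(rho-1)] leaves [1 - sg <= (1 + e/2) n t + O(1/n)], where [n t <= 1]. *)
Lemma eventually_maximizer_uniform (sg e : R) : 0 < e -> 0 <= sg ->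
  exists M : nat, forall m, (M <= m.+1)%N ->
    ell m + pi * rho * (1 - sg) * m.+1%:R `^ (rho - 1) <= ell m.+1 ->
    forall H x, Ffree_class r F m.+1 H -> lambdaQ p Q H = ell m.+1 ->
      maximizer p Q H x ->
      forall i, 1 - (sg + e) <= m.+1%:R * x i `^ p.
Proof.
move=> e0 sg0; have pe : 0 < pi * (e / 2) by rewrite mulr_gt0// divr_gt0.
have e2 : 0 < e / 2 by rewrite divr_gt0.
have [M1 H1] := eventually_density_le pe.
have [M2 H2] := @eventually_divn_le R ((1 + e / 2) * C / rho) _ e2.
(* With [n >= 2] the least entry satisfies [t <= 1/n < 1]. *)
exists (maxn 2 (maxn M1 M2)) => m; rewrite !geq_max => /and3P[m2 /H1 G1 /H2 G2].
move=> Hell H x FH Hl xmax i.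
have [x0 x1 _] := xmax.
set n := m.+1%:R in G2 Hell *.
have n2 : 2 <= n :> R by rewrite ler_nat.
have n0 : 0 < n by lra.
case: (@arg_minP _ _ 'I_m.+1 i predT (fun i => x i `^ p) isT) => v _ vmin.
apply: (@le_trans _ _ (n * x v `^ p)); last by rewrite ler_pM2l// vmin.
set t := x v `^ p.
have t0 : 0 <= t by exact: powR_ge0.
have nt1 : n * t <= 1.
  rewrite -[leRHS]x1 mulr_natl -[m.+1 in leLHS]card_ord -sumr_const.
  by apply: ler_sum => j _; exact: vmin.
have t1 : t < 1.
  have : 2 * t <= n * t by rewrite ler_wpM2r.
  by lra.
have := lambdaQ_le_deletion FH xmax t1; rewrite -/t Hl => H3.
have nr : 0 < n `^ rho by rewrite powR_gt0.
have ellE : ell m.+1 = density m.+1 * n `^ rho by rewrite /density divfK// gt_eqF.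
have powE : n `^ (rho - 1) = n `^ rho / n.
  by rewrite powRB ?powRr1 ?(ltW n0)// (gt_eqF n0) implybT.
have H4 : pi * rho * (1 - sg) / n <= density m.+1 * (rho * t + C * t ^+ 2).
  rewrite -(ler_pM2r nr); move: Hell H3; rewrite ellE powE.
  set z := n `^ rho; set c := density _ => h1 h2.
  have -> : pi * rho * (1 - sg) / n * z = pi * rho * (1 - sg) * (z / n) by field; rewrite gt_eqF.
  have -> : c * (rho * t + C * t ^+ 2) * z
    = c * z - c * z * (1 - rho * t - C * t ^+ 2) by ring.
  move: (c * z) (pi * rho * (1 - sg) * (z / n)) h1 h2 => a1 a2 h1 h2.
  by lra.
have H5 : pi * rho * (1 - sg) <= density m.+1 * (rho * (n * t) + C / n).
  move: H4; rewrite ler_pdivrMr// => /le_trans; apply.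
  have -> : density m.+1 * (rho * t + C * t ^+ 2) * n =
      density m.+1 * (rho * (n * t) + C * (n^-1 * (n * t) ^+ 2)).
    by field; rewrite gt_eqF.
  rewrite ler_wpM2l// lerD2l ler_pM2l//.
  rewrite ler_piMr ?invr_ge0 ?(ltW n0)// expr_le1//.
  exact: mulr_ge0 (ltW n0) t0.
have H6 : pi * rho * (1 - sg) <= pi * (1 + e / 2) * (rho * (n * t) + C / n).
  apply: le_trans H5 _; rewrite ler_wpM2r//; last by move: G1; lra.
  rewrite addr_ge0 ?divr_ge0 ?(ltW C_gt0) ?(ltW n0)//.
  by apply: mulr_ge0 (ltW rho_gt0) _; exact: mulr_ge0 (ltW n0) t0.
have H7 : 1 - sg <= (1 + e / 2) * (n * t) + (1 + e / 2) * C / rho / n.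
  rewrite -(ler_pM2l (mulr_gt0 pi0 rho_gt0)); apply: le_trans H6 _.
  rewrite le_eqVlt; apply/orP; left; apply/eqP.
  by field; rewrite !gt_eqF.
have : e / 2 * (n * t) <= e / 2 by rewrite ler_piMr// ltW.
by move: H7 G2; move: (_ / n) => z; lra.
Qed.

(** Growth makes the maximizer of an extremal graph almost uniform, with deviation [sg + e];
    Lagrange's condition then gives every vertex a [Q]-degree close to [pi 'C(n, s-1)] or larger. *)
Lemma eventually_degQ_ge (eps : R) : (1 < s)%N -> 0 < eps -> eps < 1 ->
  exists M : nat, forall m, (M <= m.+1)%N ->
    ell m + pi * rho * (1 - eps * pi / (s`!%:R * 5 * (s.-1)%:R))
      * m.+1%:R `^ (rho - 1) <= ell m.+1 ->
    forall H, Ffree_class r F m.+1 H -> lambdaQ p Q H = ell m.+1 ->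
      forall v, (1 - eps) * pi * 'C(m.+1, s.-1)%:R <= (degQ Q H v)%:R.
Proof.
move=> s1 eps0 eps1.
set k := s.-1; have k0 : 0 < k%:R :> R by rewrite ltr0n -ltnS prednK.
have k1 : 1 <= k%:R :> R by rewrite ler1n -ltnS prednK.
have sf0 : 0 < s`!%:R :> R by rewrite ltr0n fact_gt0.
set W := s`!%:R in sf0 *.
have Wk0 : 0 < W * k%:R by rewrite mulr_gt0.
set sg := eps * pi / _; have ep0 : 0 < eps * pi by rewrite mulr_gt0.
have sg0 : 0 < sg by rewrite divr_gt0// !mulr_gt0.
have Wsg : W * k%:R * sg = eps * pi / 5 by rewrite /sg; field; rewrite !gt_eqF.
(* Half of [sg], so that [W k dl] is three tenths of [eps pi]. *)
pose e := eps * pi / (10 * (W * k%:R)).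
have e0 : 0 < e by rewrite divr_gt0// mulr_gt0.
have We : W * k%:R * e = eps * pi / 10 by rewrite /e; field; rewrite !gt_eqF.
have ep5 : 0 < eps * pi / 5 by rewrite divr_gt0.
have [M1 H1] := eventually_maximizer_uniform e0 (ltW sg0).
have [M2 H2] := eventually_density_ge ep5.
have [M3 H3] := @eventually_divn_le R (2 * W * k%:R * k%:R) _ ep5.
(* The bound 1/2 on [k^2 / n] yields [A <= 2 B] below. *)
have [M4 H4] := @eventually_divn_le R (k%:R * k%:R) (1 / 2) (divr_gt0 ltr01 (ltr0n _ 2)).
exists (maxn (maxn M1 M2) (maxn (maxn M3 M4) s)) => m.
rewrite !geq_max -!andbA => /and5P[/H1 G1 /H2 G2 /H3 G3 /H4 G4 sm].
move=> /G1{}G1 H FH Hl v.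
have [x xmax] := maximizer_exists Q H p1 (ltn0Sn m).
have {G1}xd := G1 H x FH Hl xmax.
set dl := sg + e in xd; have dl0 : 0 < dl by exact: addr_gt0.
have Wdl : W * k%:R * dl = 3 * (eps * pi / 10) by rewrite /dl mulrDr Wsg We; lra.
have piW : pi <= W by exact: pi_le_fact.
have dl1 : dl < 1.
  rewrite -(ltr_pM2l Wk0) Wdl mulr1.
  have : eps * pi <= pi by rewrite ler_piMl// ltW.
  have : W <= W * k%:R by rewrite ler_peMr// ltW.
  by lra.
have := degQ_ge_near_uniform p1 s0 (ltn0Sn m) xmax (ltW dl0) (ltW dl1) xd v dl1.
rewrite Hl -density_expn// -/k -/W.
set n := m.+1%:R in G3 G4 *; have n0 : 0 < n by rewrite ltr0n.
have kf0 : 0 < k`!%:R :> R by rewrite ltr0n fact_gt0.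
have C1 := bin_le_expr R m.+1 k.
have km : (k <= m.+1)%N by apply: leq_trans sm; exact: leq_pred.
have C2 := @bin_ge_expr R m.+1 k isT km.
rewrite -/n in C1 C2; set A := n ^+ k / k`!%:R in C1 C2 *.
have A0 : 0 < A by rewrite divr_gt0// exprn_gt0.
have nA : n ^+ s = n * k`!%:R * A.
  by rewrite -(prednK s0) exprS -/k /A; field; rewrite gt_eqF.
rewrite nA; set B := 'C(m.+1, k)%:R in C1 C2 *; set D := (degQ Q H v)%:R.
have -> : density m.+1 * (n * k`!%:R * A) * (1 - dl) = n * k`!%:R * (density m.+1 * (1 - dl) * A).
  by ring.
rewrite ler_pM2l ?mulr_gt0// => H5.
have B0 : 0 <= B by [].
have bW : density m.+1 <= W by apply: density_le_fact => //; exists H.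
have H6 : (pi - eps * pi / 5 - W * k%:R * dl) * B <= density m.+1 * (1 - dl) * A.
  apply: (@le_trans _ _ (density m.+1 * (1 - dl) * B)); last first.
    by rewrite ler_wpM2l// mulr_ge0// subr_ge0 ltW.
  rewrite ler_wpM2r// mulrBr mulr1 lerB//.
  rewrite ler_wpM2r ?(ltW dl0)//; apply: le_trans bW _.
  by rewrite ler_peMr// ltW.
have AB : A - B <= k%:R * (k%:R / n) * A.
  by rewrite lerBlDr -lerBlDl -[X in X - _]mul1r -mulrBl.
have A2B : A <= 2 * B.
  have : k%:R * (k%:R / n) * A <= 1 / 2 * A by rewrite ler_wpM2r ?(ltW A0)// mulrA.
  by move: AB; move: (_ * A) => z; lra.
have H7 : W * (A - B) <= eps * pi / 5 * B.
  apply: (@le_trans _ _ (W * (k%:R * (k%:R / n) * (2 * B)))).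
    rewrite ler_wpM2l ?(ltW sf0)//; apply: le_trans AB _.
    by rewrite ler_wpM2l// !mulr_ge0// ?invr_ge0 ltW.
  have -> : W * (k%:R * (k%:R / n) * (2 * B)) = 2 * W * k%:R * k%:R / n * B by ring.
  by rewrite ler_wpM2r.
(* In units of [eps pi B / 10] the allowance is 10: the density costs 2, the factor [1 - dl] costs
   3, the factor [1 - k dl] costs 3, and passing between [A] and [B] costs 2. *)
have -> : (1 - eps) * pi * B = pi * B - 10 * (eps * pi / 10 * B) by field.
have H8 : (pi - eps * pi / 5 - W * k%:R * dl) * B =
   pi * B - 5 * (eps * pi / 10 * B) by rewrite Wdl; field.
have H9 : eps * pi / 5 * B = 2 * (eps * pi / 10 * B) by field.
have H10 : W * (A - (1 - k%:R * dl) * B) = W * (A - B) + 3 * (eps * pi / 10 * B).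
  have -> : W * (A - (1 - k%:R * dl) * B) = W * (A - B) + W * k%:R * dl * B by ring.
  by rewrite Wdl; field.
have z0 : 0 <= eps * pi / 10 * B by rewrite mulr_ge0// divr_ge0// ltW.
move: H5 H6 H7; rewrite H10 H8 H9; move: (eps * pi / 10 * B) z0 => z z0.
by lra.
Qed.

End asymptotics.

(** * Extremal graphs and the class of large minimum [Q]-degree *)

Unset Implicit Arguments.
Local Open Scope classical_set_scope.
Local Open Scope ring_scope.

Theorem theorem4p1 (R : realType) (p : R) (r s : nat) (eps : R)
  (Q : {set {set 'I_s}}) (F : forall m : nat, {set {set 'I_m}} -> Prop) (pi : R) :
  1 < p -> (2 <= r)%N -> (r <= s)%N -> 0 < eps -> eps < 1 ->
  is_rgraph r Q ->
  (forall m (E : {set {set 'I_m}}), F m E -> is_rgraph r E /\ no_isolated E) ->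
  (fun n : nat => exQ R r Q F n / ('C(n, s))%:R) @ \oo --> pi ->
  0 < pi ->
  let sigma := eps * pi / ((s`!)%:R * 5 * (s.-1)%:R) in
  exists N : nat, forall n0 : nat, (N <= n0)%N ->
    (forall n : nat, (n0 <= n)%N ->
       lambda_class p Q (Ffree_class r F n) >=
       lambda_class p Q (Ffree_class r F n.-1)
       + pi * (s%:R - s%:R / p) * (1 - sigma) * (n%:R `^ (s%:R - s%:R / p - 1))) ->
    forall n : nat, (n0 <= n)%N ->
    forall H : {set {set 'I_n}}, is_rgraph r H -> Ffree F H ->
      lambdaQ p Q H <= lambda_class p Q (Gclass r Q F eps pi n) /\
      (lambdaQ p Q H = lambda_class p Q (Gclass r Q F eps pi n) ->
       Gclass r Q F eps pi n H).
Proof.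
move=> p1 r2 rs eps0 eps1 _ _ exQ_cvg pi0 sigma.
have s1 : (1 < s)%N := leq_trans r2 rs.
have s0 : (0 < s)%N := ltnW s1.
have [M1 degM] := eventually_degQ_ge p1 s0 pi0 exQ_cvg s1 eps0 eps1.
have [M2 neM] := eventually_nonempty pi0 exQ_cvg.
(* [n0 >= 1] makes [n.-1] a true predecessor; beyond [M2] some F-free graph exists, hence an
   extremal one. *)
exists (maxn 1 (maxn M1 M2)) => n0; rewrite !geq_max => /and3P[n0_gt0 M1n M2n].
move=> growth n n0n H Hr HF.
have FH : Ffree_class r F n H by [].
case: n n0n H Hr HF FH => [|m] n0m H Hr HF FH.
  by move: (leq_trans n0_gt0 n0m); rewrite ltnn.
have extremal G : Ffree_class r F m.+1 G ->
    lambdaQ p Q G = lambda_class p Q (Ffree_class r F m.+1) ->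
    Gclass r Q F eps pi m.+1 G.
  move=> FG Gl; have [Gr GF] := FG; do 2!split=> //.
  exact: degM (leq_trans M1n n0m) (growth _ n0m) G FG Gl.
have [G FG Gl] := sup_finite_attained (lambdaQ p Q) (neM _ (leq_trans M2n n0m)).
have Hle : lambdaQ p Q H <= lambdaQ p Q G.
  by rewrite Gl; exact: (le_sup_finite (lambdaQ p Q)).
have Gle : lambdaQ p Q G <= lambda_class p Q (Gclass r Q F eps pi m.+1).
  by apply: (le_sup_finite (lambdaQ p Q)); exact: extremal.
split=> [|HG]; first exact: le_trans Hle Gle.
(* Equality makes [H] itself extremal, since the maximum over the large-degree class is at least the
   value of the extremal [G]. *)
apply: extremal => //; apply/eqP; rewrite eq_le -[X in _ && (X <= _)]Gl HG Gle andbT.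
by rewrite -HG -[leRHS]Gl.
Qed.
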